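(* Fix $0<p<2$. For $t>0$ let $\hat\mu_t$ be the thresholding estimator with coordinates $\hat\mu_{t,i}=X_i$ if $X_i\ge t$ and $\hat\mu_{t,i}=1$ otherwise. Then $$\liminf_{\eta\to 0}\ \inf_{t}\left[\lim_{n\to\infty}\frac{\sup_{\mu\in M_{n,p}(\eta)}R_n(\hat\mu_t,\mu)}{R_n^*(M_{n,p}(\eta))}\right]=1.$$
   Context: Observations: $X_1,\dots,X_n$ independent with $X_i\sim\mathrm{Exp}(\mu_i)$ (exponential with mean $\mu_i$), where $\mu=(\mu_1,\dots,\mu_n)$ is deterministic with all $\mu_i\ge1$. $M_{n,p}(\eta)=\{\mu\in[1,\infty)^n:\frac1n\sum_{i=1}^n\log^p(\mu_i)\le\eta^p\}$. For an estimator $\hat\mu$ with values in $(0,\infty)^n$, $R_n(\hat\mu,\mu)=\mathbb{E}_\mu\big[\frac1n\sum_{i=1}^n(\log\hat\mu_i-\log\mu_i)^2\big]$, and $R_n^*(M_{n,p}(\eta))=\inf_{\hat\mu}\sup_{\mu\in M_{n,p}(\eta)}R_n(\hat\mu,\mu)$ is the minimax risk over all estimators. The threshold $t$ may depend on $p,\eta$ but not on $n$. *)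

(* Defs.v *)
From HB Require Import structures.
From mathcomp Require Import all_boot all_order all_algebra.
From mathcomp Require Import all_classical all_reals all_analysis.
Set Implicit Arguments. Unset Strict Implicit. Unset Printing Implicit Defensive.
Import Order.TTheory GRing.Theory Num.Theory.
Local Open Scope classical_set_scope.
Local Open Scope ring_scope.

Section defs.
Variable R : realType.

(* Expectation of a nonnegative functional f(X) where X = (X_1,...,X_n) has
   independent coordinates X_i ~ Exp with mean mu_i (density
   x |-> mu_i^-1 exp(-x/mu_i) on [0,+oo)), written as the iterated Lebesgue
   integral (equal to the integral w.r.t. the product law by Tonelli). *)
Fixpoint exp_expect (n : nat) : n.-tuple R -> (n.-tuple R -> \bar R) -> \bar R :=
  match n return n.-tuple R -> (n.-tuple R -> \bar R) -> \bar R with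
  | 0 => fun _ f => f [tuple]
  | k.+1 => fun mu f =>
      (\int[lebesgue_measure]_(x in [set: R])
        ((exponential_pdf (thead mu)^-1 x)%:E *
          exp_expect (behead_tuple mu) (fun xs => f (cons_tuple x xs))))%E
  end.

Definition estimator (n : nat) (est : n.-tuple R -> n.-tuple R) : Prop :=
  measurable_fun [set: n.-tuple R] est /\
  forall x i, 0 < tnth (est x) i.

Definition risk (n : nat) (est : n.-tuple R -> n.-tuple R) (mu : n.-tuple R)
  : \bar R :=
  exp_expect mu (fun x =>
    ((n%:R)^-1 * \sum_(i < n) (ln (tnth (est x) i) - ln (tnth mu i)) ^+ 2)%:E).

Definition Mset (n : nat) (p eta : R) : set (n.-tuple R) :=
  [set mu | (forall i, 1 <= tnth mu i) /\
            (n%:R)^-1 * \sum_(i < n) (ln (tnth mu i)) `^ p <= eta `^ p].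

Definition max_risk (n : nat) (p eta : R) (est : n.-tuple R -> n.-tuple R)
  : \bar R :=
  ereal_sup [set risk est mu | mu in @Mset n p eta].

Definition minimax_risk (n : nat) (p eta : R) : \bar R :=
  ereal_inf [set @max_risk n p eta est | est in @estimator n].

Definition thresh_est (n : nat) (t : R) (x : n.-tuple R) : n.-tuple R :=
  [tuple (if t <= tnth x i then tnth x i else 1) | i < n].

Definition thresh_ratio (p eta t : R) (n : nat) : \bar R :=
  (@max_risk n p eta (@thresh_est n t) / @minimax_risk n p eta)%E.

End defs.

(* Main.v *)
(* Write [theta_i = ln mu_i].

   Limits in [n].  Concatenating two parameters of sizes [n] and [m] shows that
   [n] times the maximal risk of thresholding is superadditive.  The same holds
   for the minimax risk: up to an arbitrarily small error it is a Bayes risk for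
   a finitely supported prior, and the product of two priors adds up their Bayes
   risks.  The prior is found by clipping estimators, rounding parameters down to
   a finite grid and applying an elementary minimax theorem to the risk vectors.
   By Fekete's lemma both normalized risks converge to their suprema over [n].

   Upper bound.  With [T = ln t], the risk of one coordinate is at most
   [16 exp(-t / 2e) + (19 + T^(2-p)) theta^p], so the maximal risk is at most
   [16 exp(-t / 2e) + (19 + T^(2-p)) eta^p] for every [n].

   Lower bound.  Put a single spike [theta = T - S] at a uniform position among
   about [theta^p / eta^p] coordinates.  If [eta^p = exp(-t / 2e)] its position
   cannot be found, hence the supremum of the minimax risks is at least
   [(1 - o(1)) eta^p T^(2-p)], and the ratio of the two bounds tends to one. *)
Require Import Defs.
From HB Require Import structures.
From mathcomp Require Import all_boot all_order all_algebra.
From mathcomp Require Import all_classical all_reals all_analysis.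
From mathcomp Require Import measurable_realfun ring lra.
Set Implicit Arguments.
Unset Strict Implicit.
Unset Printing Implicit Defensive.
Import Order.TTheory GRing.Theory Num.Theory.
Import numFieldNormedType.Exports.
Local Open Scope classical_set_scope.
Local Open Scope ring_scope.

(** * Exponential expectations *)

(** The statement is a liminf, so its upper half needs only one family of [eta] tending to 0 and
    tolerates crude constants. The lower half is immediate: thresholding takes part in the infimum
    defining [minimax_risk], so no limiting ratio is below 1.

    The term to match is [eta^p T^(2-p)]. It stems from [theta^2 = theta^p theta^(2-p)] with [theta]
    near [T], about the largest signal that thresholding still discards; as [p < 2], it dominates
    every fixed multiple of [eta^p]. False alarms at [theta <= 1] cost [16 exp(-t / 2e)], and the
    choice of [eta^p] turns this into such a multiple. Truncating the spiked observation at [t / 4e]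
    bounds the likelihood ratio between two positions below by [r = exp(-t / 4e)], while there are
    at least [r^-2] positions. The product [r^-1] diverges, so the spike cannot be located. *)

Section density.
Context d (T : measurableType d) (R : realType).
Variables (mu P : {measure set T -> \bar R}) (g : T -> R).
Hypotheses (mg : measurable_fun [set: T] g) (g0 : forall x, 0 <= g x).
Hypothesis PE : forall A, measurable A -> P A = (\int[mu]_(x in A) (g x)%:E)%E.

Import HBNNSimple.

Let integral_density_nnsfun (h : {nnsfun T >-> R}) :
  (\int[P]_x (h x)%:E = \int[mu]_x ((g x)%:E * (h x)%:E))%E.
Proof.
under [LHS]eq_integral do rewrite fimfunE -fsumEFin//.
rewrite [LHS]ge0_integral_fsum//; last 2 first.
  - by move=> r; exact/measurable_EFinP/measurableT_comp.
  - by move=> n x _; rewrite EFinM nnfun_muleindic_ge0.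
under [RHS]eq_integral.
  move=> x xD; rewrite fimfunE -fsumEFin// ge0_mule_fsumr; last first.
    by move=> r; rewrite EFinM nnfun_muleindic_ge0.
  over.
rewrite [RHS]ge0_integral_fsum//; last 2 first.
  - move=> r; under eq_fun do rewrite -EFinM.
    by apply/measurable_EFinP/measurable_funM => //; apply/measurableT_comp.
  - move=> n x _; rewrite EFinM mule_ge0 ?lee_fin//.
    by have := nnfun_muleindic_ge0 h n x; rewrite -EFinM lee_fin.
apply: eq_fsbigr => r _.
rewrite integralZl_indic_nnsfun// integral_indic// setIT PE//.
rewrite [in LHS]integral_mkcond/=.
have [r0|r0] := ltP r 0.
  rewrite preimage_nnfun0// (eq_integral (cst 0%E)); last first.
    by move=> x _ /=; rewrite patchE in_set0.
  rewrite integral0 mule0; apply/esym; apply: integral0_eq => x _.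
  by rewrite indicE in_set0 mulr0 mule0.
rewrite -ge0_integralZl//.
- apply: eq_integral => x _; rewrite patchE indicE.
  by case: ifPn => _; rewrite ?mulr1 ?mulr0 ?mule0// muleC.
- apply/(measurable_restrictT _ _).1 => //.
  by apply/measurable_EFinP; exact: measurable_funTS.
- by move=> x _; rewrite patchE; case: ifPn => // _; rewrite lee_fin.
Qed.

(** Simple functions satisfy the identity and monotone convergence extends it. It turns the density
    factors of [exp_expect] into integration against probability measures. *)
Lemma ge0_integral_density (f : T -> \bar R) :
  measurable_fun [set: T] f -> (forall x, 0 <= f x)%E ->
  (\int[P]_x f x = \int[mu]_x ((g x)%:E * f x))%E.
Proof.
move=> mf f0; pose f_ := nnsfun_approx measurableT mf.
transitivity (lim (\int[P]_x (f_ n x)%:E @[n --> \oo])%E).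
  rewrite -monotone_convergence//=.
  - by apply: eq_integral => x _; apply/esym/cvg_lim => //; exact: cvg_nnsfun_approx.
  - by move=> n; exact/measurable_EFinP/measurable_funTS.
  - by move=> n ? _; rewrite lee_fin.
  - by move=> ? _ ? ? mn; rewrite lee_fin; exact/lefP/nd_nnsfun_approx.
under eq_fun do rewrite integral_density_nnsfun.
rewrite -monotone_convergence//=.
- apply: eq_integral => x _; apply/cvg_lim => //.
  by apply: cvgeZl => //; exact: cvg_nnsfun_approx.
- move=> n; under eq_fun do rewrite -EFinM.
  by apply/measurable_EFinP/measurable_funM.
- by move=> n ? _; rewrite -EFinM lee_fin mulr_ge0.
- move=> x _ m n mn; rewrite -!EFinM lee_fin ler_wpM2l//.
  exact/lefP/nd_nnsfun_approx.
Qed.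

End density.

Section exp_expect.
Context {R : realType}.
Local Notation leb := (@lebesgue_measure R).

(* [R] carries two convertible measurable structures that differ by their
   display; the Lebesgue measure lives on the second one. *)
Local Notation RR := (measurableTypeR R).

Lemma exponential_density (r : R) : 0 < r ->
  exists Q : probability RR R, forall f : RR -> \bar R,
    measurable_fun [set: RR] f -> (forall x, 0 <= f x)%E ->
    (\int[Q]_x f x = \int[leb]_x ((exponential_pdf r x)%:E * f x))%E.
Proof.
move=> r0; unshelve refine (ex_intro _ (exponential_prob r : probability _ _) _) => //=.
move=> f mf f0.
apply: (@ge0_integral_density _ _ _ leb (exponential_prob r : probability _ _)) => //.
- exact: measurable_exponential_pdf.
- by move=> x; exact/exponential_pdf_ge0/ltW.
Qed.

Definition cons_pair n (z : RR * n.-tuple R) : n.+1.-tuple R :=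
  cons_tuple z.1 z.2.

Lemma measurable_cons_pair n : measurable_fun [set: RR * n.-tuple R] (@cons_pair n).
Proof.
have m1 : measurable_fun [set: RR * n.-tuple R] (fun z => z.1 : R).
  exact: measurable_fst.
exact: (measurable_cons m1 measurable_snd).
Qed.

HB.instance Definition _ n :=
  @isMeasurableFun.Build _ _ _ _ (@cons_pair n) (@measurable_cons_pair n).

(** The law is the image of a product measure under [cons_pair], and Tonelli unfolds it into the
    iterated integral. Linearity, monotonicity and exchange of expectations are all obtained through
    it. *)
Lemma exp_expect_measure n (mu : n.-tuple R) : (forall i, 0 < tnth mu i) ->
  exists P : probability (n.-tuple R) R, forall f : n.-tuple R -> \bar R,
    measurable_fun [set: n.-tuple R] f -> (forall x, 0 <= f x)%E ->
    exp_expect mu f = (\int[P]_x f x)%E.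
Proof.
elim: n mu => [|n IH] mu mu0.
  exists (@dirac _ _ ([tuple] : 0.-tuple R) R : probability _ _) => f mf f0.
  by rewrite /= integral_dirac// diracT mul1e.
have r0 : 0 < (thead mu)^-1 by rewrite invr_gt0; exact: mu0.
have [|P HP] := IH (behead_tuple mu).
  by move=> i; rewrite tnth_behead.
have [Q HQ] := exponential_density r0.
pose PP : probability (RR * n.-tuple R)%type R := (Q \x P)%E.
exists (distribution PP (@cons_pair n) : probability _ _) => f mf f0.
have mfc : measurable_fun [set: RR * n.-tuple R] (f \o @cons_pair n).
  by apply: measurableT_comp => //; exact: measurable_cons_pair.
rewrite ge0_integral_pushforward//=.
rewrite /PP fubini_tonelli1//=.
rewrite HQ//; last 2 first.
- exact: (measurable_fun_fubini_tonelli_F (m2 := P)).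
- by move=> x; exact: integral_ge0.
apply: eq_integral => x _; congr (_ * _)%E.
rewrite HP//.
exact: (measurableT_comp mfc (measurable_pair1 x)).
Qed.

Lemma measurable_exp_expect d (T : measurableType d) n (mu : n.-tuple R)
    (f : T * n.-tuple R -> \bar R) : (forall i, 0 < tnth mu i) ->
  measurable_fun [set: T * n.-tuple R] f -> (forall z, 0 <= f z)%E ->
  measurable_fun [set: T] (fun x => exp_expect mu (fun y => f (x, y))).
Proof.
move=> /exp_expect_measure[P HP] mf f0.
apply: (eq_measurable_fun (fubini_F P f)).
  move=> x _; rewrite HP//.
  exact: (measurableT_comp mf (measurable_pair1 x)).
exact: measurable_fun_fubini_tonelli_F.
Qed.

Lemma exp_expect_cat n m (mu : n.-tuple R) (nu : m.-tuple R) f :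
  exp_expect (cat_tuple mu nu) f =
  exp_expect mu (fun x => exp_expect nu (fun y => f (cat_tuple x y))).
Proof.
elim: n mu f => [|n IH] mu f.
  rewrite /= (_ : cat_tuple mu nu = nu :> (0 + m).-tuple R); last first.
    by apply: val_inj; rewrite tuple0.
  by congr (exp_expect _ _); apply/funext => y; congr f; exact: val_inj.
rewrite [in LHS]/= [in RHS]/=; apply: eq_integral => x _; congr (_ * _)%E.
  by congr ((exponential_pdf _ _)%:E); case/tupleP: mu.
transitivity (exp_expect (cat_tuple (behead_tuple mu) nu)
    (fun y => f (cons_tuple x y : (n.+1 + m).-tuple R))).
  congr (exp_expect _ _).
  by apply: val_inj; case/tupleP: mu.
rewrite IH; congr (exp_expect _ _); apply/funext => y.
congr (exp_expect _ _); apply/funext => z; congr f.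
exact: val_inj.
Qed.

Lemma exp_expect_cst n (mu : n.-tuple R) (c : R) : (forall i, 0 < tnth mu i) ->
  0 <= c -> exp_expect mu (fun=> c%:E) = c%:E.
Proof.
move=> /exp_expect_measure[P HP] c0; rewrite HP//.
by rewrite integral_cst// [X in (_ * X)%E](probability_setT P) mule1.
Qed.

Lemma integral_exp_pdf_cst (a : R) (c : \bar R) : 0 < a -> (0 <= c)%E ->
  (\int[leb]_x ((exponential_pdf a^-1 x)%:E * c) = c)%E.
Proof.
move=> a0 c0; under eq_integral do rewrite muleC.
rewrite ge0_integralZl//.
- by rewrite integral_exponential_pdf ?mule1// invr_gt0.
- by apply/measurable_EFinP; exact: measurable_exponential_pdf.
- by move=> x _; rewrite lee_fin exponential_pdf_ge0// invr_ge0 ltW.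
Qed.

Lemma exp_expect_ge0 n (mu : n.-tuple R) f : (forall i, 0 < tnth mu i) ->
  (forall x, 0 <= f x)%E -> (0 <= exp_expect mu f)%E.
Proof.
elim: n mu f => [|n IH] mu f mu0 f0 //=.
apply: integral_ge0 => x _; apply: mule_ge0.
  by rewrite lee_fin exponential_pdf_ge0// invr_ge0 ltW//; exact: mu0.
by apply: IH => // i; rewrite tnth_behead.
Qed.

Lemma exp_expect_tnth n (mu : n.-tuple R) (i : 'I_n) (g : R -> R) :
  (forall i, 0 < tnth mu i) ->
  measurable_fun [set: R] g -> (forall x, 0 <= g x) ->
  exp_expect mu (fun x => (g (tnth x i))%:E) =
  (\int[leb]_x ((exponential_pdf (tnth mu i)^-1 x)%:E * (g x)%:E))%E.
Proof.
move=> + mg g0; elim: n mu i => [|n IH] mu i mu0; first by case: i.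
have mu0' j : 0 < tnth (behead_tuple mu) j by rewrite tnth_behead.
have [j ->|->] := unliftP ord0 i.
  have -> : tnth mu (lift ord0 j) = tnth (behead_tuple mu) j.
    by rewrite [in LHS](tuple_eta mu) tnthS.
  rewrite -IH// [RHS](_ : _ = (\int[leb]_x ((exponential_pdf (thead mu)^-1 x)%:E *
     exp_expect (behead_tuple mu) (fun x => (g (tnth x j))%:E)))%E); last first.
    rewrite integral_exp_pdf_cst//; first exact: mu0.
    by apply: exp_expect_ge0 => // x; rewrite lee_fin.
  apply: eq_integral => x _; congr (_ * _)%E; congr (exp_expect _ _).
  by apply/funext => y; rewrite tnthS.
apply: eq_integral => x _; congr (_ * _)%E.
rewrite -[RHS](exp_expect_cst mu0')//.
Qed.

(** One-sided change of measure: [w i] is a lower bound for the likelihood ratio of [nu] against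
    [mu] in coordinate [i], and independence multiplies these bounds. It serves twice, to move a
    parameter to a grid point and to move a spike to another position. *)
Lemma exp_expect_weight n (mu nu : n.-tuple R) (w : 'I_n -> R -> R)
    (f : n.-tuple R -> \bar R) :
  (forall i, 0 < tnth mu i) -> (forall i, 0 < tnth nu i) ->
  (forall i, measurable_fun [set: R] (w i)) -> (forall i x, 0 <= w i x) ->
  (forall i x, w i x * exponential_pdf (tnth mu i)^-1 x <=
               exponential_pdf (tnth nu i)^-1 x) ->
  measurable_fun [set: n.-tuple R] f -> (forall x, 0 <= f x)%E ->
  (exp_expect mu (fun x => (\prod_(i < n) w i (tnth x i))%:E * f x) <=
   exp_expect nu f)%E.
Proof.
elim: n mu nu w f => [|n IH] mu nu w f mu0 nu0 mw w0 wmunu mf f0.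
  by rewrite /= big_ord0 mul1e.
have mu0' j : 0 < tnth (behead_tuple mu) j by rewrite tnth_behead.
have nu0' j : 0 < tnth (behead_tuple nu) j by rewrite tnth_behead.
have mfc : measurable_fun [set: RR * n.-tuple R] (f \o @cons_pair n).
  by apply: measurableT_comp => //; exact: measurable_cons_pair.
pose W (x : n.-tuple R) := \prod_(i < n) w (lift ord0 i) (tnth x i).
have mW : measurable_fun [set: n.-tuple R] W.
  apply: measurable_prod => i _; apply: measurableT_comp => //.
  exact: measurable_tnth.
have W0 x : 0 <= W x by apply: prodr_ge0.
have mWf : measurable_fun [set: RR * n.-tuple R]
    (fun z => (W z.2)%:E * f (cons_tuple z.1 z.2))%E.
  apply: emeasurable_funM => //.
  by apply/measurable_EFinP; exact: measurableT_comp.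
have mwp : measurable_fun [set: RR]
    (fun x => (w ord0 x * exponential_pdf (thead mu)^-1 x)%:E).
  apply/measurable_EFinP/measurable_funM; first exact: mw.
  exact: measurable_exponential_pdf.
have p0 (m : n.+1.-tuple R) x : (forall i, 0 < tnth m i) ->
    0 <= exponential_pdf (thead m)^-1 x.
  by move=> m0; rewrite exponential_pdf_ge0// invr_ge0 ltW//; exact: m0.
rewrite /= [leLHS](_ : _ = \int[leb]_x
   ((w ord0 x * exponential_pdf (thead mu)^-1 x)%:E *
     exp_expect (behead_tuple mu) (fun xs => (W xs)%:E * f (cons_tuple x xs))))%E; last first.
  apply: eq_integral => x _.
  rewrite [in RHS]EFinM -muleA [RHS]muleCA; congr (_ * _)%E.
  have [P HP] := exp_expect_measure mu0'.
  have mWfx : measurable_fun [set: n.-tuple R] (fun y => (W y)%:E * f (cons_tuple x y))%E.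
    exact: (measurableT_comp mWf (measurable_pair1 x)).
  have Wf0 y : (0 <= (W y)%:E * f (cons_tuple x y))%E by rewrite mule_ge0// lee_fin.
  rewrite (HP (fun y => (W y)%:E * f (cons_tuple x y))%E)//.
  rewrite -ge0_integralZl//; last by rewrite lee_fin.
  rewrite -HP.
  - congr (exp_expect _ _); apply/funext => y.
    rewrite muleA -EFinM; congr (_%:E * _)%E.
    by rewrite big_ord_recl /W; congr (_ * _); apply: eq_bigr => i _; rewrite tnthS.
  - exact: measurable_funeM.
  - by move=> y; rewrite mule_ge0// lee_fin.
apply: ge0_le_integral => //.
- move=> x _; apply: mule_ge0; first by rewrite lee_fin mulr_ge0// p0.
  by apply: exp_expect_ge0 => // y; rewrite mule_ge0// lee_fin.
- apply: emeasurable_funM => //.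
  by apply: (measurable_exp_expect (f := fun z => (W z.2)%:E * f (cons_tuple z.1 z.2))%E) => // z; rewrite mule_ge0// lee_fin.
- apply: emeasurable_funM => //.
    by apply/measurable_EFinP; exact: measurable_exponential_pdf.
  by apply: (measurable_exp_expect (f := f \o @cons_pair n)) => // z; exact: f0.
- move=> x _; apply: lee_pmul => //.
  + by rewrite lee_fin mulr_ge0// p0.
  + by apply: exp_expect_ge0 => // y; rewrite mule_ge0// lee_fin.
  + rewrite lee_fin; exact: wmunu.
  + apply: (IH _ _ (fun i => w (lift ord0 i)) (fun xs => f (cons_tuple x xs))) => //.
    * move=> i y; have := wmunu (lift ord0 i) y.
      have tb (m : n.+1.-tuple R) : tnth m (lift ord0 i) = tnth (behead_tuple m) i.
        by rewrite [in LHS](tuple_eta m) tnthS.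
      by rewrite !tb.
    * exact: (measurableT_comp mfc (measurable_pair1 x)).
Qed.

End exp_expect.

(** * Superadditive sequences and a finite minimax theorem *)

Section fekete.
Context {R : realType}.
Variables (u : nat -> R) (C : R).
Hypotheses (u0 : forall n, 0 <= u n) (uC : forall n, u n <= C).
Hypothesis superu : forall n m, (0 < n)%N -> (0 < m)%N ->
  n%:R * u n + m%:R * u m <= (n + m)%:R * u (n + m)%N.

(** Strong induction removes blocks of length [n] from [N] and replaces a division with remainder.
    The incomplete block costs at most one [n], whence the factor [N - n]; for [N < n] the left side
    is nonpositive. *)
Let superu_mul n N : (0 < n)%N -> (N%:R - n%:R) * u n <= N%:R * u N.
Proof.
move=> n0; elim/ltn_ind: N => N IH.
have [Nn|nN|->] := ltngtP N n.
- rewrite (@le_trans _ _ 0)//; last by rewrite mulr_ge0.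
  by rewrite mulr_le0_ge0// subr_le0 ler_nat ltnW.
- have Nn0 : (0 < N - n)%N by rewrite subn_gt0.
  have := superu n0 Nn0; rewrite subnKC//; last exact: ltnW.
  have := IH (N - n)%N; rewrite ltn_subrL n0 (leq_trans n0 (ltnW nN)) => /(_ isT).
  rewrite natrB; last exact: ltnW.
  nra.
- by rewrite subrr mul0r mulr_ge0.
Qed.

Lemma superadditive_cvg : u n @[n --> \oo] --> sup [set u n | n in [set n | (0 < n)%N]].
Proof.
set S := [set u n | n in _].
have hS : has_sup S.
  by split; [exists (u 1), 1%N|exists C => _ [n _ <-]].
apply/cvgrPdist_le => e e0.
have e20 : 0 < e / 2 by rewrite divr_gt0.
have [_ [n n0 <-] lun] := sup_adherent e20 hS.
near=> N.
have N0 : (0 < N)%N by near: N; exact: nbhs_infty_gt.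
have uS : u N <= sup S by apply: (sup_upper_bound hS); exists N.
rewrite ger0_norm ?subr_ge0//.
have NC : n%:R * C <= N%:R * (e / 2).
  rewrite -ler_pdivrMr//; near: N; exact: nbhs_infty_ger.
have NR0 : 0 < N%:R :> R by rewrite ltr0n.
have := superu_mul N n0; have := uC n => unC h.
have : N%:R * u n <= N%:R * (u N + e / 2).
  have : n%:R * u n <= n%:R * C by rewrite ler_wpM2l.
  by move: h NC; rewrite mulrBl mulrDr; lra.
by rewrite ler_pM2l//; lra.
Unshelve. all: by end_near.
Qed.

End fekete.

Section finite_minimax.
Context {R : realType} (I : finType) (T : Type).
Variables (D : set T) (r : T -> I -> R) (b v v' : R).
Hypotheses (vv' : v < v') (D0 : D !=set0).
Hypothesis rb : forall x i, D x -> 0 <= r x i <= b.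
Hypothesis convr : forall x y s, D x -> D y -> 0 <= s <= 1 ->
  exists2 z, D z & forall i, r z i <= (1 - s) * r x i + s * r y i.
Hypothesis maxr : forall x, D x -> exists i, v' <= r x i.

Let pos (x : R) := Num.max x 0.
Let Phi (x : T) := \sum_i (pos (r x i - v)) ^+ 2.

Let pos_sqr (x y : R) : pos (x + y) ^+ 2 <= pos x ^+ 2 + 2 * pos x * y + y ^+ 2.
Proof.
rewrite /pos; case: (leP x 0) => x0; case: (leP (x + y) 0) => xy0; nra.
Qed.

(** The weights are the excesses [pos (r x i - v)] at a near minimizer [x] of [Phi], the squared
    distance from the risk vector to the orthant below [v]; they are the normal of a separating
    hyperplane. No minimizer has to exist: the gap between [v] and [v'] keeps the infimum [d]
    positive, and an approximate first-order condition is enough. *)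
Lemma finite_minimax : exists pi : I -> R,
  [/\ forall i, 0 <= pi i, \sum_i pi i = 1 &
      forall x, D x -> v <= \sum_i pi i * r x i].
Proof.
have posge0 x : 0 <= pos x by rewrite /pos le_max lexx orbT.
have pos_homo x y : x <= y -> pos x <= pos y.
  by move=> xy; rewrite /pos ge_max !le_max xy lexx orbT.
pose S := [set Phi x | x in D].
have Phi0 x : 0 <= Phi x by apply: sumr_ge0 => i _; exact: sqr_ge0.
have Phi_lb x : D x -> (v' - v) ^+ 2 <= Phi x.
  move=> Dx; have [i ri] := maxr Dx.
  rewrite /Phi (bigD1 i)//= -[leLHS]addr0 lerD//; last first.
    by apply: sumr_ge0 => j _; exact: sqr_ge0.
  rewrite lerXn2r ?nnegrE ?subr_ge0 ?(ltW vv')//.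
  by rewrite /pos le_max lerD2r ri.
have hS : has_inf S.
  split; first by case: D0 => x Dx; exists (Phi x), x.
  by exists 0 => _ [x _ <-].
pose d := inf S.
have d0 : 0 < d.
  apply: (@lt_le_trans _ _ ((v' - v) ^+ 2)).
    by rewrite exprn_gt0// subr_gt0.
  by apply: lb_le_inf; [case: hS|move=> _ [x Dx <-]; exact: Phi_lb].
pose M := #|I|%:R * b ^+ 2 : R.
have M0 : 0 <= M by rewrite mulr_ge0// sqr_ge0.
(* The step [s] along a segment keeps the second-order term small, [s M <= d]. The point [x] is then
   taken within [s d] of the infimum, so that its defect is also of first order in [s]. *)
pose s := Num.min 1 (d / (M + 1)).
have s0 : 0 < s by rewrite /s lt_min ltr01 divr_gt0//; lra.
have s1 : s <= 1 by rewrite /s ge_min lexx.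
have sM : s * M <= d.
  have : s <= d / (M + 1) by rewrite /s ge_min lexx orbT.
  rewrite ler_pdivlMr; last lra.
  by rewrite mulrDr; lra.
have [_ [x Dx <-] Phix] : exists2 y, S y & y < d + s * d.
  by apply: inf_adherent => //; exact: mulr_gt0.
pose w i := pos (r x i - v).
have W2 : \sum_i w i ^+ 2 = Phi x by [].
have wv i : w i * (r x i - v) = w i ^+ 2.
  by rewrite /w /pos; case: leP => h; rewrite ?mul0r ?expr2 ?mul0r.
have key y : D y -> 0 <= \sum_i w i * (r y i - v).
  move=> Dy; have [|z Dz hz] := convr (s := s) Dx Dy; first by rewrite ltW.
  have dz : d <= Phi z by apply: ge_inf; [case: hS|exists z].
  have : Phi z <= Phi x + 2 * s * (\sum_i w i * (r y i - r x i)) + s ^+ 2 * M.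
    have -> : M = \sum_(i : I) b ^+ 2 by rewrite sumr_const /M mulr_natl.
    rewrite /Phi !mulr_sumr -!big_split/=; apply: ler_sum => i _.
    set c := r y i - r x i.
    have c2 : c ^+ 2 <= b ^+ 2.
      by have := rb i Dx; have := rb i Dy; rewrite /c => /andP[? ?] /andP[? ?]; nra.
    apply: (@le_trans _ _ (pos (r x i - v + s * c) ^+ 2)).
      rewrite lerXn2r ?nnegrE//; apply: pos_homo.
      by have := hz i; rewrite /c; lra.
    apply: (le_trans (pos_sqr _ _)).
    have s2 : 0 <= s ^+ 2 by exact: sqr_ge0.
    have : s ^+ 2 * c ^+ 2 <= s ^+ 2 * b ^+ 2 by rewrite ler_wpM2l.
    by rewrite -/(w i) exprMn; lra.
  set X := \sum_i w i * (r y i - r x i) => hPhi.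
  have -> : \sum_i w i * (r y i - v) = X + Phi x.
    rewrite -W2 /X -big_split/=; apply: eq_bigr => i _.
    by rewrite -wv; lra.
  have dx : d <= Phi x by apply: ge_inf; [case: hS|exists x].
  (* This combines [d <= Phi z] with the expansion of [Phi] along the segment. Dividing by [s] and
     using [s M <= d] gives [- d <= X], and [d <= Phi x] concludes. *)
  have : 0 <= s * (d + 2 * X + s * M) by nra.
  by rewrite pmulr_rge0//; lra.
have W0 : 0 < \sum_i w i.
  rewrite lt_neqAle eq_sym sumr_ge0 ?andbT; last by move=> i _; exact: posge0.
  apply/negP => /eqP W0.
  have wi0 i : w i = 0.
    exact: (psumr_eq0P (fun i _ => posge0 (r x i - v)) W0).
  suff : Phi x = 0 by have : d <= Phi x; [apply: ge_inf; [case: hS|exists x]|lra].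
  by rewrite -W2 big1// => i _; rewrite wi0 expr0n.
exists (fun i => w i / \sum_i w i); split.
- by move=> i; rewrite divr_ge0 ?posge0// ltW.
- by rewrite -mulr_suml divff// gt_eqF.
- move=> y Dy; rewrite (eq_bigr (fun i => w i * r y i / \sum_i w i)); last first.
    by move=> i _; rewrite mulrAC.
  rewrite -mulr_suml ler_pdivlMr//.
  have := key y Dy.
  under eq_bigr do rewrite mulrBr.
  by rewrite sumrB -mulr_suml subr_ge0 mulrC.
Qed.

End finite_minimax.

(** * Risk of thresholding in one coordinate *)

Section thresholding_risk.
Context {R : realType}.
Local Notation leb := (@lebesgue_measure R).

Lemma is_derive_xln2 (c x : R) : 0 < x ->
  is_derive x 1 (fun y => y * ((ln y - c) ^+ 2 - 2 * (ln y - c) + 2)) ((ln x - c) ^+ 2).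
Proof.
move=> x0; have dln := is_derive1_ln x0.
pose L : R -> R := ln (R:=R) - cst c.
have dL : is_derive x 1 L (x^-1 - 0) by apply: is_deriveB.
have -> : (fun y => y * ((ln y - c) ^+ 2 - 2 * (ln y - c) + 2)) =
   (@id R : R -> R) * (L ^+ 2 - 2 *: L + cst 2).
  apply/funext => y; rewrite /L /=.
  by rewrite /GRing.mul/= /GRing.add/= /GRing.opp/=.
have := is_deriveM (is_derive_id x (1:R)) (is_deriveD (is_deriveB (is_deriveX 2 dL) (is_deriveZ 2 dL)) (is_derive_cst (2:R) x (1:R))).
move=> h; apply: (is_derive_eq h).
rewrite -[LHS]/(x * (2 * (ln x - c) ^+ 1 * (x^-1 - 0) - 2 * (x^-1 - 0) + 0) +
  ((ln x - c) ^+ 2 - 2 * (ln x - c) + 2) * 1).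
by field; rewrite gt_eqF.
Qed.

(** The antiderivative [F] equals 2 at [m], and [F t >= 0] because
    [z^2 - 2 z + 2 = (z - 1)^2 + 1]. *)
Lemma integral_ln2_le (t m : R) : 0 < t -> t <= m ->
  (\int[leb]_(x in `[t, m]) (m^-1 * (ln x - ln m) ^+ 2)%:E <= 2%:E)%E.
Proof.
move=> t0; rewrite le_eqVlt => /predU1P[->|tm].
  by rewrite set_itv1 integral_set1 lee_fin.
have m0 : 0 < m by exact: lt_trans tm.
pose F (y : R) := m^-1 * (y * ((ln y - ln m) ^+ 2 - 2 * (ln y - ln m) + 2)).
have dF (x : R) : 0 < x -> is_derive x 1 F (m^-1 * (ln x - ln m) ^+ 2).
  by move=> x0; exact: (is_deriveZ m^-1 (is_derive_xln2 (ln m) x0)).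
have cF (x : R) : 0 < x -> {for x, continuous F}.
  by move=> /dF [? _]; apply: differentiable_continuous; exact/derivable1_diffP.
rewrite (@continuous_FTC2 _ _ F)//.
- rewrite -EFinB lee_fin {1}/F subrr expr0n/= mulr0 subr0 add0r mulrA mulVf ?gt_eqF// mul1r.
  rewrite gerBl /F mulr_ge0 ?invr_ge0 ?(ltW m0)// mulr_ge0 ?(ltW t0)//.
  set z := ln t - ln m; nra.
- apply: continuous_in_subspaceT => x; rewrite inE/= in_itv/= => /andP[tx _].
  have x0 : 0 < x by exact: lt_le_trans tx.
  have cl : ln y - ln m @[y --> x] --> ln x - ln m.
    by apply: cvgB; [exact: continuous_ln|exact: cvg_cst].
  apply: cvgM; first exact: cvg_cst.
  rewrite expr2; under eq_fun do rewrite expr2.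
  exact: cvgM.
- split.
  + move=> x; rewrite in_itv/= => /andP[tx _].
    by have [] := dF x (lt_trans t0 tx).
  + by apply: cvg_at_right_filter; exact: cF.
  + by apply: cvg_at_left_filter; exact: cF.
- move=> x; rewrite in_itv/= => /andP[tx _].
  rewrite derive1E; by have [_ ->] := dF x (lt_trans t0 tx).
Qed.

Lemma exponential_tail (a s : R) : 0 < a -> 0 < s ->
  (\int[leb]_(x in `[s, +oo[) (exponential_pdf a x)%:E <= (expR (- a * s))%:E)%E.
Proof.
move=> a0 s0.
have <- : (1 - exponential_prob a `[0%R, s] = (expR (- a * s))%:E)%E.
  rewrite exponential_prob_itv0c//.
  by rewrite -[LHS]/((1 - (1 - expR (- a * s)))%:E) opprB addrCA subrr addr0.
have [Q QE] : exists Q : probability (measurableTypeR R) R, forall A, Q A = exponential_prob a A.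
  by unshelve refine (ex_intro _ (exponential_prob a : probability _ _) _).
rewrite -QE -probability_setC// QE -integral_itv_obnd_cbnd; last first.
  by apply/measurable_EFinP/measurable_funTS; exact: measurable_exponential_pdf.
apply: ge0_subset_integral => //.
- exact: measurableC.
- by apply/measurable_EFinP/measurable_funTS; exact: measurable_exponential_pdf.
- by move=> x _; rewrite lee_fin exponential_pdf_ge0// ltW.
- by move=> x/=; rewrite !in_itv/= andbT => sx; rewrite (leNgt x) sx andbF.
Qed.

Lemma ln2_le_expR (y : R) : 1 <= y -> ln y ^+ 2 <= 8 * expR (y / 2).
Proof.
move=> y1.
have l0 : 0 <= ln y by exact: ln_ge0.
have ly : ln y <= y by have := @le_ln1Dx R (y - 1); rewrite addrCA subrr addr0 => /(_ ltac:(lra)); lra.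
have := @expR_ge1Dxn R (y / 2) 1.
rewrite /= !factS fact0 => /(_ ltac:(lra)).
have -> : ((2 * (1 * 1))%N%:R = 2 :> R) by [].
nra.
Qed.

(** Half of the exponential decay pays for the squared logarithm. The constant 16 is the 8 of
    [ln2_le_expR] times the ratio 2 between the normalizations of the two densities. *)
Lemma ln2_exponential_pdf_le (m x : R) : 0 < m -> m <= x ->
  exponential_pdf m^-1 x * (ln x - ln m) ^+ 2 <= 16 * exponential_pdf (2 * m)^-1 x.
Proof.
move=> m0 mx; have x0 : 0 < x by exact: lt_le_trans mx.
rewrite !exponential_pdfE ?(ltW x0)//.
have xm1 : 1 <= x / m by rewrite ler_pdivlMr// mul1r.
have := ln2_le_expR xm1; rewrite ln_div ?posrE// => h.
have -> : - (2 * m)^-1 * x = - m^-1 * x + x / m / 2 by field; rewrite gt_eqF.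
rewrite expRD.
have -> : 16 * ((2 * m)^-1 * (expR (- m^-1 * x) * expR (x / m / 2))) =
  m^-1 * expR (- m^-1 * x) * (8 * expR (x / m / 2)) by field; rewrite gt_eqF.
by rewrite ler_wpM2l// mulr_ge0 ?expR_ge0// invr_ge0 ltW.
Qed.

Definition coord_risk (t m : R) : \bar R :=
  (\int[leb]_x ((exponential_pdf m^-1 x)%:E *
     ((ln (if t <= x then x else 1) - ln m) ^+ 2)%:E))%E.

Lemma measurable_coord_loss (t m : R) :
  measurable_fun [set: R] (fun x : R => (ln (if t <= x then x else 1) - ln m) ^+ 2).
Proof.
apply: measurable_funX; apply: measurable_funB => //.
apply: measurableT_comp => //; apply: measurable_fun_if => //.
exact: measurable_fun_ler.
Qed.

(** Three ranges of the observation: between [t] and [m] the density is at most [m^-1]; above both,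
    [ln2_exponential_pdf_le] leaves a tail of half the rate; below [t] the estimate is 1 and the
    loss is [ln m ^+ 2]. *)
Lemma coord_risk_le (t m : R) : 0 < t -> 0 < m ->
  (coord_risk t m <=
   \int[leb]_(x in `[t, m]) (m^-1 * (ln x - ln m) ^+ 2)%:E +
   (16 * expR (- (2 * m)^-1 * Num.max t m) +
    ln m ^+ 2 * (1 - expR (- m^-1 * t)))%:E)%E.
Proof.
move=> t0 m0; set s := Num.max t m.
have s0 : 0 < s by rewrite lt_max t0.
have m20 : 0 < (2 * m)^-1 by rewrite invr_gt0 mulr_gt0.
have mi0 : 0 < m^-1 by rewrite invr_gt0.
have mpdf (a : R) (U : set R) : measurable_fun U (fun x : R => (exponential_pdf a x)%:E).
  by apply/measurable_EFinP/measurable_funTS; exact: measurable_exponential_pdf.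
have pdf0 (a x : R) : 0 < a -> (0 <= (exponential_pdf a x)%:E)%E.
  by move=> a0; rewrite lee_fin exponential_pdf_ge0// ltW.
have mA : measurable_fun [set: R] (fun x : R => (m^-1 * (ln x - ln m) ^+ 2)%:E).
  apply/measurable_EFinP; apply: measurable_funM => //; apply: measurable_funX.
  exact: measurable_funB.
have A0 (x : R) : (0 <= (m^-1 * (ln x - ln m) ^+ 2)%:E)%E.
  by rewrite lee_fin mulr_ge0 ?(ltW mi0)// sqr_ge0.
pose A (x : R) := (((fun x => (m^-1 * (ln x - ln m) ^+ 2)%:E) \_ `[t, m]) x : \bar R).
pose B (x : R) := (((fun x => 16%:E * (exponential_pdf (2 * m)^-1 x)%:E)%E \_ `[s, +oo[) x : \bar R).
pose C (x : R) := (((fun x => (ln m ^+ 2)%:E * (exponential_pdf m^-1 x)%:E)%E \_ `[0%R, t]) x : \bar R).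
have HA x : (0 <= A x)%E by rewrite /A patchE; case: ifP.
have HB x : (0 <= B x)%E.
  by rewrite /B patchE; case: ifP => // _; rewrite mule_ge0 ?pdf0// lee_fin.
have HC x : (0 <= C x)%E.
  by rewrite /C patchE; case: ifP => // _; rewrite mule_ge0 ?pdf0// lee_fin sqr_ge0.
have MA : measurable_fun [set: R] A.
  by apply/(measurable_restrictT _ _).1 => //; exact: measurable_funTS.
have MB : measurable_fun [set: R] B.
  by apply/(measurable_restrictT _ _).1 => //; exact: measurable_funeM.
have MC : measurable_fun [set: R] C.
  by apply/(measurable_restrictT _ _).1 => //; exact: measurable_funeM.
apply: (@le_trans _ _ (\int[leb]_x (A x + (B x + C x)))%E).
  apply: ge0_le_integral => //.
  - by move=> x _; rewrite mule_ge0 ?pdf0// lee_fin sqr_ge0.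
  - apply: emeasurable_funM => //; first exact: mpdf.
    by apply/measurable_EFinP; exact: measurable_coord_loss.
  - by apply: emeasurable_funD => //; exact: emeasurable_funD.
  - move=> x _.
    have [x0|x0] := ltP x 0.
      by rewrite lt0_exponential_pdf// mul0e !adde_ge0.
    have [tx|xt] := leP t x; last first.
      apply: (@le_trans _ _ (C x)); last by rewrite addeA leeDr// adde_ge0.
      rewrite /C patchE ifT; last by rewrite inE/= in_itv/= x0 ltW.
      by rewrite ln1 sub0r sqrrN muleC.
    have [xm|mx] := leP x m.
      apply: (@le_trans _ _ (A x)); last by rewrite leeDl// adde_ge0.
      rewrite /A patchE ifT; last by rewrite inE/= in_itv/= tx.
      rewrite -EFinM lee_fin ler_wpM2r ?sqr_ge0// exponential_pdfE//.
      rewrite -[leRHS]mulr1 ler_wpM2l// ?(ltW mi0)//.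
      by rewrite -expR0 ler_expR mulNr oppr_le0 mulr_ge0// ltW.
    apply: (@le_trans _ _ (B x)).
      rewrite /B patchE ifT; last first.
        by rewrite inE/= in_itv/= andbT /s ge_max tx ltW.
      by rewrite -!EFinM lee_fin ln2_exponential_pdf_le// ltW.
    by rewrite addeCA leeDl// adde_ge0.
have HBC x : (0 <= B x + C x)%E by rewrite adde_ge0.
have MBC : measurable_fun [set: R] (fun x => B x + C x)%E by exact: emeasurable_funD.
rewrite ge0_integralD// ge0_integralD// EFinD -!integral_mkcond; apply: leeD => //.
apply: leeD.
  rewrite ge0_integralZl//; [|exact: mpdf|by move=> x _; exact: pdf0].
  by rewrite EFinM lee_pmul2l// exponential_tail.
rewrite ge0_integralZl//; [|exact: mpdf|by move=> x _; exact: pdf0|by rewrite lee_fin sqr_ge0].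
by rewrite [leRHS]EFinM -[(1 - _)%:E]/(1 - (expR (- m^-1 * t))%:E)%E -exponential_prob_itv0c.
Qed.

Lemma coord_risk_ge0 (t m : R) : 0 < m -> (0 <= coord_risk t m)%E.
Proof.
move=> m0; apply: integral_ge0 => x _.
by rewrite mule_ge0// lee_fin ?sqr_ge0// exponential_pdf_ge0// invr_ge0 ltW.
Qed.

Lemma coord_risk_le_gen (t m : R) : 0 < t -> 0 < m ->
  (coord_risk t m <= (18 + ln m ^+ 2 * (1 - expR (- m^-1 * t)))%:E)%E.
Proof.
move=> t0 m0; apply: (le_trans (coord_risk_le t0 m0)).
rewrite [leRHS](_ : _ = 2%:E + (16 + ln m ^+ 2 * (1 - expR (- m^-1 * t)))%:E)%E; last first.
  by rewrite -EFinD addrA -natrD.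
apply: leeD.
  have [tm|mt] := leP t m; first exact: integral_ln2_le.
  by rewrite set_itv_ge ?integral_set0// ?lee_fin// bnd_simp -ltNge.
rewrite lee_fin lerD2r -[leRHS]mulr1 ler_wpM2l// -expR0 ler_expR mulNr oppr_le0.
by rewrite mulr_ge0 ?le_max ?(ltW t0)// invr_ge0 mulr_ge0// ltW.
Qed.

(** The middle range is empty and the tail keeps its exponential factor. Near [m = 1] the constant
    18 of the general bound would swamp a risk that has to be small with [eta]. *)
Lemma coord_risk_le_small (t m : R) : 0 < m -> m < t ->
  (coord_risk t m <= (16 * expR (- (2 * m)^-1 * t) + ln m ^+ 2)%:E)%E.
Proof.
move=> m0 mt; have t0 : 0 < t by exact: lt_trans mt.
apply: (le_trans (coord_risk_le t0 m0)).
rewrite set_itv_ge ?integral_set0 ?add0e; last by rewrite bnd_simp -ltNge.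
rewrite lee_fin max_l ?(ltW mt)// lerD2l -[leRHS]mulr1 ler_wpM2l ?sqr_ge0//.
Qed.

End thresholding_risk.

(** * Risk of an estimator and its maximum *)

Section risk.
Context {R : realType}.
Variables (p eta : R).
Hypothesis p0 : 0 < p.

Lemma Mset_gt0 n (mu : n.-tuple R) : Mset p eta mu -> forall i, 0 < tnth mu i.
Proof. by move=> [mu1 _] i; exact: lt_le_trans (mu1 i). Qed.

Lemma MsetP n (mu : n.-tuple R) : (0 < n)%N -> Mset p eta mu <->
  (forall i, 1 <= tnth mu i) /\ \sum_(i < n) (ln (tnth mu i)) `^ p <= n%:R * eta `^ p.
Proof.
by move=> n0; rewrite /Mset/= mulrC ler_pdivrMr ?ltr0n// [in X in _ <-> X]mulrC.
Qed.

Lemma Mset_ones n : Mset p eta [tuple (1:R) | i < n].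
Proof.
split=> [i|]; first by rewrite tnth_mktuple.
rewrite big1 ?mulr0 ?powR_ge0// => i _.
by rewrite tnth_mktuple ln1 powR0// gt_eqF.
Qed.

(** The budgets [n eta^p] and [m eta^p] add up; both superadditivity results rest on this. *)
Lemma Mset_cat n m (mu : n.-tuple R) (nu : m.-tuple R) : (0 < n)%N -> (0 < m)%N ->
  Mset p eta mu -> Mset p eta nu -> Mset p eta (cat_tuple mu nu).
Proof.
move=> n0 m0 /(MsetP _ n0)[mu1 hmu] /(MsetP _ m0)[nu1 hnu].
apply/MsetP; first by rewrite addn_gt0 n0.
split.
  by move=> i; case: (split_ordP i) => j ->; rewrite ?tnth_lshift ?tnth_rshift.
rewrite big_split_ord/= natrD mulrDl; apply: lerD.
  by under eq_bigr do rewrite tnth_lshift.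
by under eq_bigr do rewrite tnth_rshift.
Qed.

Definition loss n (est : n.-tuple R -> n.-tuple R) (mu : n.-tuple R) (i : 'I_n)
  (x : n.-tuple R) := (ln (tnth (est x) i) - ln (tnth mu i)) ^+ 2.

Lemma measurable_loss n (est : n.-tuple R -> n.-tuple R) mu i : estimator est ->
  measurable_fun [set: n.-tuple R] (loss est mu i).
Proof.
move=> [mest _]; apply: measurable_funX; apply: measurable_funB => //.
apply: measurableT_comp => //.
exact: (measurableT_comp (@measurable_tnth _ _ n i) mest).
Qed.

Lemma risk_ge0 n (est : n.-tuple R -> n.-tuple R) mu :
  (forall i, 0 < tnth mu i) -> (0 <= risk est mu)%E.
Proof.
move=> mu0; apply: exp_expect_ge0 => // x; rewrite lee_fin mulr_ge0//.
by apply: sumr_ge0 => i _; exact: sqr_ge0.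
Qed.

Lemma risk_sum n (est : n.-tuple R -> n.-tuple R) mu : estimator est ->
  (forall i, 0 < tnth mu i) ->
  risk est mu = ((n%:R^-1)%:E * \sum_(i < n) exp_expect mu (fun x => (loss est mu i x)%:E))%E.
Proof.
move=> eest mu0; have [P HP] := exp_expect_measure mu0.
have ml i : measurable_fun [set: n.-tuple R] (fun x => (loss est mu i x)%:E).
  by apply/measurable_EFinP; exact: measurable_loss.
have l0 i x : (0 <= (loss est mu i x)%:E)%E by rewrite lee_fin sqr_ge0.
under eq_bigr do rewrite HP//.
rewrite -ge0_integral_sum// -ge0_integralZl//; last 2 first.
- exact: emeasurable_sum.
- by move=> x _; apply: sume_ge0.
rewrite -HP.
- congr (exp_expect _ _); apply/funext => x.
  by rewrite EFinM sumEFin.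
- by apply: measurable_funeM; exact: emeasurable_sum.
- by move=> x; rewrite mule_ge0// ?sume_ge0// lee_fin.
Qed.

Lemma thresh_estimator n (t : R) : 0 < t -> estimator (@thresh_est R n t).
Proof.
move=> t0; split; last first.
  move=> x i; rewrite tnth_mktuple; case: ifPn => // /(lt_le_trans t0).
  exact.
apply/measurable_fun_tnthP => i.
apply: (eq_measurable_fun (fun x : n.-tuple R => if t <= tnth x i then tnth x i else 1)).
  by move=> x _; rewrite /= tnth_mktuple.
have mt := @measurable_tnth _ R n i.
apply: measurable_fun_if => //.
- exact: measurable_fun_ler.
- exact: measurable_funTS.
Qed.

Lemma risk_thresh n (t : R) (mu : n.-tuple R) : 0 < t -> (forall i, 0 < tnth mu i) ->
  risk (@thresh_est R n t) mu =
  ((n%:R^-1)%:E * \sum_(i < n) coord_risk t (tnth mu i))%E.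
Proof.
move=> t0 mu0; rewrite risk_sum//; last exact: thresh_estimator.
congr (_ * _)%E; apply: eq_bigr => i _.
rewrite /coord_risk -exp_expect_tnth//.
- by congr (exp_expect _ _); apply/funext => x; rewrite /loss tnth_mktuple.
- exact: measurable_coord_loss.
- by move=> x; exact: sqr_ge0.
Qed.

(** The growth [ln m ^+ 2 <= 2 m] is compensated by the probability, at most [t / m], of falling
    below the threshold. The absence of [m] from the bound makes all maximal risks finite. *)
Lemma coord_risk_bound (t m : R) : 0 < t -> 1 <= m ->
  (coord_risk t m <= (18 + 2 * t)%:E)%E.
Proof.
move=> t0 m1; have m0 : 0 < m by exact: lt_le_trans m1.
apply: (le_trans (coord_risk_le_gen t0 m0)).
rewrite lee_fin lerD2l.
have l0 : 0 <= ln m by exact: ln_ge0.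
have h1 : 1 - expR (- m^-1 * t) <= t / m.
  by have := expR_ge1Dx (- m^-1 * t); rewrite [t / m]mulrC; lra.
have h2 : ln m ^+ 2 <= 2 * m.
  have := @expR_ge1Dxn R (ln m) 1 l0; rewrite lnK ?posrE//.
  rewrite /= !factS fact0 -[(2 * (1 * 1))%N%:R]/(2 : R).
  have := sqr_ge0 (ln m); lra.
apply: (@le_trans _ _ (2 * m * (t / m))).
  by apply: ler_pM => //; [exact: sqr_ge0|rewrite subr_ge0 -expR0 ler_expR mulNr oppr_le0 mulr_ge0 ?(ltW t0)// invr_ge0 ltW].
by rewrite mulrACA mulrA -mulrA mulrAC divff ?gt_eqF// mulr1 mulrC.
Qed.

Lemma coord_risk_fin (t m : R) : 0 < t -> 1 <= m ->
  coord_risk t m = (fine (coord_risk t m))%:E.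
Proof.
move=> t0 m1; rewrite fineK// ge0_fin_numE.
  exact: le_lt_trans (coord_risk_bound t0 m1) (ltry _).
by apply: coord_risk_ge0; exact: lt_le_trans m1.
Qed.

Lemma risk_thresh_fin n (t : R) (mu : n.-tuple R) : 0 < t -> (forall i, 1 <= tnth mu i) ->
  risk (@thresh_est R n t) mu = (n%:R^-1 * \sum_(i < n) fine (coord_risk t (tnth mu i)))%:E.
Proof.
move=> t0 mu1; rewrite risk_thresh//; last by move=> i; exact: lt_le_trans (mu1 i).
by rewrite EFinM -sumEFin; congr (_ * _)%E; apply: eq_bigr => i _; exact: coord_risk_fin.
Qed.

Lemma max_risk_ub n (est : n.-tuple R -> n.-tuple R) (mu : n.-tuple R) :
  Mset p eta mu -> (risk est mu <= max_risk p eta est)%E.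
Proof. by move=> Mmu; apply: ereal_sup_ubound; exists mu. Qed.

Lemma max_risk_ge0 n (est : n.-tuple R -> n.-tuple R) : (0 <= max_risk p eta est)%E.
Proof.
apply: le_trans (max_risk_ub est (Mset_ones n)); apply: risk_ge0.
exact: (Mset_gt0 (Mset_ones n)).
Qed.

Lemma max_risk_thresh_le n (t a b : R) : 0 < t -> 0 <= a -> 0 <= b ->
  (forall m, 1 <= m -> (coord_risk t m <= (a + b * ln m `^ p)%:E)%E) ->
  (max_risk p eta (@thresh_est R n t) <= (a + b * eta `^ p)%:E)%E.
Proof.
move=> t0 a0 b0 h; apply: ge_ereal_sup => _ [mu [mu1 hmu] <-].
rewrite risk_thresh_fin// lee_fin.
case: n mu mu1 hmu => [|n] mu mu1 hmu.
  by rewrite big_ord0 mulr0 addr_ge0// mulr_ge0// powR_ge0.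
apply: (@le_trans _ _ (n.+1%:R^-1 * \sum_(i < n.+1) (a + b * ln (tnth mu i) `^ p))).
  rewrite ler_wpM2l// ler_sum// => i _.
  by rewrite -lee_fin -coord_risk_fin// h.
rewrite big_split/= sumr_const card_ord -[a *+ _]mulr_natl mulrDr mulKf ?pnatr_eq0//.
by rewrite lerD2l -mulr_sumr mulrCA ler_wpM2l.
Qed.

Section fin.
Variable t : R.
Hypothesis t0 : 0 < t.

Lemma max_risk_thresh_bound n : (max_risk p eta (@thresh_est R n t) <= (18 + 2 * t)%:E)%E.
Proof.
have := @max_risk_thresh_le n t (18 + 2 * t) 0 t0.
rewrite mul0r addr0; apply => //; first by rewrite addr_ge0// mulr_ge0// ltW.
by move=> m m1; rewrite mul0r addr0; exact: coord_risk_bound.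
Qed.

Lemma max_risk_thresh_fin n :
  max_risk p eta (@thresh_est R n t) = (fine (max_risk p eta (@thresh_est R n t)))%:E.
Proof.
rewrite fineK// ge0_fin_numE ?max_risk_ge0//.
exact: le_lt_trans (max_risk_thresh_bound n) (ltry _).
Qed.

Lemma max_risk_thresh_superadditive n m : (0 < n)%N -> (0 < m)%N ->
  n%:R * fine (max_risk p eta (@thresh_est R n t)) +
  m%:R * fine (max_risk p eta (@thresh_est R m t)) <=
  (n + m)%:R * fine (max_risk p eta (@thresh_est R (n + m) t)).
Proof.
move=> n0 m0.
pose S k (mu : k.-tuple R) := \sum_(i < k) fine (coord_risk t (tnth mu i)).
have n0' : 0 < n%:R :> R by rewrite ltr0n.
have m0' : 0 < m%:R :> R by rewrite ltr0n.
set A := (n + m)%:R * _.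
have step mu nu : @Mset R n p eta mu -> @Mset R m p eta nu -> S n mu + S m nu <= A.
  move=> Mmu Mnu.
  have := max_risk_ub (@thresh_est R (n + m) t) (Mset_cat n0 m0 Mmu Mnu).
  have [cat1 _] := Mset_cat n0 m0 Mmu Mnu.
  rewrite risk_thresh_fin// max_risk_thresh_fin lee_fin mulrC ler_pdivrMr ?ltr0n ?addn_gt0 ?n0//.
  rewrite mulrC -/A big_split_ord/=; apply: le_trans.
  by apply: lerD; apply: ler_sum => i _; rewrite ?tnth_lshift ?tnth_rshift.
have step2 nu : @Mset R m p eta nu ->
    n%:R * fine (max_risk p eta (@thresh_est R n t)) <= A - S m nu.
  move=> Mnu; rewrite mulrC -ler_pdivlMr//.
  rewrite -lee_fin -max_risk_thresh_fin; apply: ge_ereal_sup => _ [mu Mmu <-].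
  rewrite risk_thresh_fin; [|exact: t0|exact: Mmu.1].
  rewrite lee_fin mulrC ler_pM2r ?invr_gt0//.
  by rewrite lerBrDr; exact: step.
rewrite -lerBrDl mulrC -ler_pdivlMr//.
rewrite -lee_fin -max_risk_thresh_fin; apply: ge_ereal_sup => _ [nu Mnu <-].
rewrite risk_thresh_fin; [|exact: t0|exact: Mnu.1].
rewrite lee_fin mulrC ler_pM2r ?invr_gt0//.
by have := step2 _ Mnu; rewrite lerBrDr -/(S m nu); lra.
Qed.

End fin.

End risk.

(** * Least favorable priors *)

Section prior.
Context {R : realType}.

Lemma exp_expect_le n (mu : n.-tuple R) (f g : n.-tuple R -> \bar R) :
  (forall i, 0 < tnth mu i) ->
  measurable_fun [set: n.-tuple R] f -> measurable_fun [set: n.-tuple R] g ->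
  (forall x, 0 <= f x)%E -> (forall x, f x <= g x)%E ->
  (exp_expect mu f <= exp_expect mu g)%E.
Proof.
move=> /exp_expect_measure[P HP] mf mg f0 fg.
rewrite !HP//; last by move=> x; exact: le_trans (fg x).
exact: ge0_le_integral.
Qed.

Lemma exp_expectD n (mu : n.-tuple R) (f g : n.-tuple R -> \bar R) :
  (forall i, 0 < tnth mu i) ->
  measurable_fun [set: n.-tuple R] f -> measurable_fun [set: n.-tuple R] g ->
  (forall x, 0 <= f x)%E -> (forall x, 0 <= g x)%E ->
  (exp_expect mu (fun x => f x + g x) = exp_expect mu f + exp_expect mu g)%E.
Proof.
move=> /exp_expect_measure[P HP] mf mg f0 g0.
rewrite !HP//.
- exact: ge0_integralD.
- exact: emeasurable_funD.
- by move=> x; rewrite adde_ge0.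
Qed.

Lemma exp_expectZ n (mu : n.-tuple R) (c : R) (f : n.-tuple R -> \bar R) :
  (forall i, 0 < tnth mu i) -> 0 <= c ->
  measurable_fun [set: n.-tuple R] f -> (forall x, 0 <= f x)%E ->
  (exp_expect mu (fun x => c%:E * f x) = c%:E * exp_expect mu f)%E.
Proof.
move=> /exp_expect_measure[P HP] c0 mf f0.
rewrite !HP//.
- exact: ge0_integralZl_EFin.
- exact: measurable_funeM.
- by move=> x; rewrite mule_ge0// lee_fin.
Qed.

Lemma exp_expect_sum n (mu : n.-tuple R) (I : Type) (s : seq I) (f : I -> n.-tuple R -> \bar R) :
  (forall i, 0 < tnth mu i) ->
  (forall i, measurable_fun [set: n.-tuple R] (f i)) ->
  (forall i x, 0 <= f i x)%E ->
  (exp_expect mu (fun x => \sum_(i <- s) f i x) = \sum_(i <- s) exp_expect mu (f i))%E.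
Proof.
move=> /exp_expect_measure[P HP] mf f0.
rewrite HP; last 2 first.
- exact: emeasurable_sum.
- by move=> x; rewrite sume_ge0.
by rewrite ge0_integral_sum//; apply: eq_bigr => i _; rewrite HP.
Qed.

Lemma exp_expect_swap n m (mu : n.-tuple R) (nu : m.-tuple R)
    (f : n.-tuple R * m.-tuple R -> \bar R) :
  (forall i, 0 < tnth mu i) -> (forall i, 0 < tnth nu i) ->
  measurable_fun [set: n.-tuple R * m.-tuple R] f -> (forall z, 0 <= f z)%E ->
  exp_expect mu (fun x => exp_expect nu (fun y => f (x, y))) =
  exp_expect nu (fun y => exp_expect mu (fun x => f (x, y))).
Proof.
move=> mu0 nu0 mf f0.
have mf' : measurable_fun [set: m.-tuple R * n.-tuple R] (fun z => f (z.2, z.1)).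
  by apply: (measurableT_comp mf); exact: measurable_swap.
have [P HP] := exp_expect_measure mu0; have [Q HQ] := exp_expect_measure nu0.
rewrite HP//; last 2 first.
- exact: measurable_exp_expect.
- by move=> x; exact: exp_expect_ge0.
rewrite HQ//; last 2 first.
- exact: (measurable_exp_expect (f := fun z => f (z.2, z.1))).
- by move=> x; exact: exp_expect_ge0.
rewrite (eq_integral (fun x => \int[Q]_y f (x, y))%E); last first.
  by move=> x _; rewrite HQ//; exact: (measurableT_comp mf (measurable_pair1 x)).
rewrite [RHS](eq_integral (fun y => \int[P]_x f (x, y))%E); last first.
  by move=> y _; rewrite HP//; exact: (measurableT_comp mf (measurable_pair2 y)).
exact: fubini_tonelli.
Qed.

Lemma exp_expect_bounded n (mu : n.-tuple R) (c : R) (f : n.-tuple R -> R) :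
  (forall i, 0 < tnth mu i) -> measurable_fun [set: n.-tuple R] f ->
  (forall x, 0 <= f x <= c) ->
  exists2 a, exp_expect mu (fun x => (f x)%:E) = a%:E & 0 <= a <= c.
Proof.
move=> mu0 mf fc.
have c0 : 0 <= c by have /andP[] := fc mu; exact: le_trans.
have h0 : (0 <= exp_expect mu (fun x => (f x)%:E))%E.
  by apply: exp_expect_ge0 => // x; rewrite lee_fin; case/andP: (fc x).
have hc : (exp_expect mu (fun x => (f x)%:E) <= c%:E)%E.
  rewrite -(exp_expect_cst mu0 c0); apply: exp_expect_le => //.
  - exact/measurable_EFinP.
  - by move=> x; rewrite lee_fin; case/andP: (fc x).
  - by move=> x; rewrite lee_fin; case/andP: (fc x).
exists (fine (exp_expect mu (fun x => (f x)%:E))).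
  by rewrite fineK// ge0_fin_numE// (le_lt_trans hc) ?ltry.
by rewrite -!lee_fin fineK ?h0// ge0_fin_numE// (le_lt_trans hc) ?ltry.
Qed.

(** Since [nu] is rounded down, [expR (- h)] times each of its densities lies below that of [mu],
    which bounds expectations under [mu] from below. Applied to [c - f], this becomes an upper bound
    for [f]; the loss [1 - expR (- (n h))] is at most [n h]. *)
Lemma exp_expect_round n (mu nu : n.-tuple R) (c h : R) (f : n.-tuple R -> R) :
  (forall i, 0 < tnth nu i) -> 0 <= h ->
  (forall i, tnth nu i <= tnth mu i <= expR h * tnth nu i) ->
  measurable_fun [set: n.-tuple R] f -> (forall x, 0 <= f x <= c) ->
  (exp_expect mu (fun x => (f x)%:E) <=
   exp_expect nu (fun x => (f x)%:E) + (c * (n%:R * h))%:E)%E.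
Proof.
move=> nu0 h0 numu mf fc.
have mu0 i : 0 < tnth mu i by case/andP: (numu i) => + _; exact: lt_le_trans.
have c0 : 0 <= c by have /andP[] := fc mu; exact: le_trans.
pose g x := c - f x.
have mg : measurable_fun [set: n.-tuple R] g by exact: measurable_funB.
have gc x : 0 <= g x <= c by have := fc x; rewrite /g; lra.
have [a Ea ac] := exp_expect_bounded mu0 mf fc.
have [b Eb bc] := exp_expect_bounded nu0 mf fc.
have [a' Ea' _] := exp_expect_bounded mu0 mg gc.
have [b' Eb' bc'] := exp_expect_bounded nu0 mg gc.
have f0 x : (0 <= (f x)%:E)%E by rewrite lee_fin; case/andP: (fc x).
have g0 x : (0 <= (g x)%:E)%E by rewrite lee_fin; case/andP: (gc x).
have mEf : measurable_fun [set: n.-tuple R] (fun x => (f x)%:E) by exact/measurable_EFinP.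
have mEg : measurable_fun [set: n.-tuple R] (fun x => (g x)%:E) by exact/measurable_EFinP.
have sum (m : n.-tuple R) (u v : R) : (forall i, 0 < tnth m i) ->
    exp_expect m (fun x => (f x)%:E) = u%:E -> exp_expect m (fun x => (g x)%:E) = v%:E ->
    u + v = c.
  move=> m0 Eu Ev; have := exp_expectD m0 mEf mEg f0 g0.
  rewrite Eu Ev -EFinD => /eqP; rewrite (_ : (fun _ => _) = fun=> c%:E).
    by rewrite exp_expect_cst// eqe => /eqP.
  by apply/funext => x; rewrite -EFinD /g addrCA subrr addr0.
have s1 := sum _ _ _ mu0 Ea Ea'; have s2 := sum _ _ _ nu0 Eb Eb'.
have := @exp_expect_weight R n nu mu (fun _ _ => expR (- h)) (fun x => (g x)%:E) nu0 mu0.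
move=> /(_ (fun=> measurable_cst _) (fun _ _ => expR_ge0 _)).
have : forall i (x : R), expR (- h) * exponential_pdf (tnth nu i)^-1 x <=
    exponential_pdf (tnth mu i)^-1 x.
  move=> i x; have [x0|x0] := ltP x 0; first by rewrite !lt0_exponential_pdf ?mulr0.
  rewrite !exponential_pdfE// mulrA; have /andP[h1 h2] := numu i.
  apply: ler_pM => //.
  - by rewrite mulr_ge0 ?expR_ge0// invr_ge0 ltW.
  - by rewrite expRN -invfM lef_pV2 ?posrE ?mulr_gt0 ?expR_gt0.
  - by rewrite ler_expR !mulNr lerN2 ler_wpM2r// lef_pV2 ?posrE.
move=> hw /(_ hw mEg g0).
under eq_fun do rewrite prodr_const card_ord.
rewrite exp_expectZ//.
rewrite Ea' Eb' Ea Eb -EFinM -EFinD !lee_fin -expRM_natl => hab.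
have /andP[b'0 b'c] := bc'.
have e1 : (1 + n%:R * - h) * b' <= expR (n%:R * - h) * b'.
  by rewrite ler_wpM2r// expR_ge1Dx.
have e2 : n%:R * h * b' <= n%:R * h * c by rewrite ler_wpM2l// mulr_ge0.
lra.
Qed.

Lemma risk_le n (e1 e2 : n.-tuple R -> n.-tuple R) (mu : n.-tuple R) :
  estimator e1 -> estimator e2 -> (forall i, 0 < tnth mu i) ->
  (forall x i, loss e1 mu i x <= loss e2 mu i x) -> (risk e1 mu <= risk e2 mu)%E.
Proof.
move=> ee1 ee2 mu0 h; rewrite !risk_sum//.
rewrite lee_wpmul2l ?lee_fin// lee_sum// => i _.
apply: exp_expect_le => //.
- by apply/measurable_EFinP; exact: measurable_loss.
- by apply/measurable_EFinP; exact: measurable_loss.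
- by move=> x; rewrite lee_fin sqr_ge0.
- by move=> x; rewrite lee_fin.
Qed.

Definition bounded_estimator n (B : R) (est : n.-tuple R -> n.-tuple R) :=
  estimator est /\ forall x i, 0 <= ln (tnth (est x) i) <= B.

Lemma avg_le n (c : R) (F : 'I_n -> R) : 0 <= c -> (forall i, F i <= c) ->
  n%:R^-1 * \sum_(i < n) F i <= c.
Proof.
case: n F => [|n] F c0 Fc; first by rewrite big_ord0 mulr0.
rewrite mulrC ler_pdivrMr ?ltr0n//.
apply: (le_trans (ler_sum _ (fun i _ => Fc i))).
by rewrite sumr_const card_ord -[c *+ _]mulr_natl mulrC.
Qed.

Lemma measurable_avg_loss n (est : n.-tuple R -> n.-tuple R) (mu : n.-tuple R) :
  estimator est ->
  measurable_fun [set: n.-tuple R] (fun x => n%:R^-1 * \sum_(i < n) loss est mu i x).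
Proof.
move=> eest; apply: measurable_funM => //; apply: measurable_sum => i.
exact: measurable_loss.
Qed.

Lemma avg_loss_bounded n (B : R) (est : n.-tuple R -> n.-tuple R) (mu x : n.-tuple R) :
  0 <= B ->
  bounded_estimator B est -> (forall i, 0 <= ln (tnth mu i) <= B) ->
  0 <= n%:R^-1 * \sum_(i < n) loss est mu i x <= B ^+ 2.
Proof.
move=> B0 [eest best] mu0; apply/andP; split.
  by rewrite mulr_ge0// sumr_ge0// => i _; exact: sqr_ge0.
apply: avg_le; first exact: sqr_ge0.
by move=> i; have := best x i; have := mu0 i; rewrite /loss => /andP[? ?] /andP[? ?]; nra.
Qed.

(** Two errors arise: [2 B h] because the squared loss is [2 B]-Lipschitz in the target on [[0, B]],
    and [B^2 n h] because the law of the data changes while the loss stays below [B^2]. *)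
Lemma risk_round n (B h : R) (est : n.-tuple R -> n.-tuple R) (mu nu : n.-tuple R) :
  0 <= B -> 0 <= h -> bounded_estimator B est ->
  (forall i, 1 <= tnth nu i) -> (forall i, ln (tnth mu i) <= B) ->
  (forall i, tnth nu i <= tnth mu i <= expR h * tnth nu i) ->
  (risk est mu <= risk est nu + (2 * B * h + B ^+ 2 * (n%:R * h))%:E)%E.
Proof.
move=> B0 h0 best nu1 muB numu; have [eest estB] := best.
have nu0 i : 0 < tnth nu i by exact: lt_le_trans (nu1 i).
have mu0 i : 0 < tnth mu i by case/andP: (numu i) => + _; exact: lt_le_trans.
have lmu i : ln (tnth nu i) <= ln (tnth mu i) <= h + ln (tnth nu i).
  have /andP[h1 h2] := numu i; apply/andP; split; first by rewrite ler_ln ?posrE.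
  by rewrite -[X in X + _]expRK -lnM ?posrE ?expR_gt0// ler_ln ?posrE// mulr_gt0// expR_gt0.
have nuB i : 0 <= ln (tnth nu i) <= B.
  by rewrite ln_ge0//= (le_trans _ (muB i))//; case/andP: (lmu i).
pose f x := n%:R^-1 * \sum_(i < n) loss est nu i x.
have mf : measurable_fun [set: n.-tuple R] f by exact: measurable_avg_loss.
have fB x : 0 <= f x <= B ^+ 2 by exact: avg_loss_bounded.
have Bh0 : 0 <= 2 * B * h by rewrite !mulr_ge0.
apply: (@le_trans _ _ (exp_expect mu (fun x => (f x)%:E + (2 * B * h)%:E)%E)).
  apply: exp_expect_le => //.
  - by apply/measurable_EFinP; exact: measurable_avg_loss.
  - by apply: emeasurable_funD => //; exact/measurable_EFinP.
  - by move=> x; rewrite lee_fin mulr_ge0// sumr_ge0// => i _; exact: sqr_ge0.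
  - move=> x; rewrite lee_fin -lerBlDl /f -mulrBr -sumrB; apply: avg_le => // i.
    rewrite /loss; have := estB x i; have := lmu i; have := nuB i; have := muB i.
    move: (ln _) (ln (tnth mu i)) (ln (tnth nu i)) => d a b ? /andP[? ?] /andP[? ?] /andP[? ?].
    have : 0 <= (a - b) * (2 * B - (a + b - 2 * d)) by apply: mulr_ge0; lra.
    have : 0 <= (h - (a - b)) * (2 * B) by apply: mulr_ge0; lra.
    lra.
rewrite exp_expectD//; last 2 first.
- exact/measurable_EFinP.
- by move=> x; rewrite lee_fin; case/andP: (fB x).
rewrite exp_expect_cst// EFinD [X in (_ <= _ + X)%E]addeC addeA; apply: leeD => //.
exact: exp_expect_round.
Qed.

End prior.

Section minimax_prior.
Context {R : realType}.
Variables (p eta : R).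
Hypothesis p0 : 0 < p.

(** At worst the whole budget sits on one coordinate. For fixed [n] the parameters are therefore
    bounded, as clipping and the finite grid require. *)
Lemma Mset_ln_le n (mu : n.-tuple R) : Mset p eta mu ->
  forall i, ln (tnth mu i) <= (n%:R * eta `^ p) `^ p^-1.
Proof.
case: n mu => [|n] mu Mmu i; first by case: i.
have [mu1 hmu] := (MsetP _ _ _ (ltn0Sn n)).1 Mmu.
have l0 j : 0 <= ln (tnth mu j) by exact: ln_ge0.
rewrite -[leLHS](@powRr1 _ (ln (tnth mu i)))// -[X in _ `^ X](divff (lt0r_neq0 p0)) powRrM.
apply: ge0_ler_powR; rewrite ?invr_ge0 ?(ltW p0)// ?nnegrE ?powR_ge0//.
  by rewrite mulr_ge0// powR_ge0.
apply: le_trans hmu; rewrite (bigD1 i)//= lerDl sumr_ge0// => j _.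
exact: powR_ge0.
Qed.

Definition clip (B y : R) := Num.min B (Num.max 0 y).

Lemma clip_itv B y : 0 <= B -> 0 <= clip B y <= B.
Proof. by move=> B0; rewrite /clip le_min B0 le_max lexx ge_min lexx. Qed.

Lemma clip_dist B y a : 0 <= a <= B -> (clip B y - a) ^+ 2 <= (y - a) ^+ 2.
Proof.
by move=> /andP[a0 aB]; rewrite /clip; case: (leP 0 y) => y0; case: (leP B _) => yB; nra.
Qed.

Definition clip_est n B (est : n.-tuple R -> n.-tuple R) (x : n.-tuple R) : n.-tuple R :=
  [tuple expR (clip B (ln (tnth (est x) i))) | i < n].

(** A convex combination on the logarithmic scale, where the loss is quadratic and thus convex. It
    supplies the segments that [finite_minimax] asks for. *)
Definition geomean_est n (s : R) (e1 e2 : n.-tuple R -> n.-tuple R) (x : n.-tuple R)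
  : n.-tuple R :=
  [tuple expR ((1 - s) * ln (tnth (e1 x) i) + s * ln (tnth (e2 x) i)) | i < n].

Lemma measurable_ln_est n (est : n.-tuple R -> n.-tuple R) i : estimator est ->
  measurable_fun [set: n.-tuple R] (fun x => ln (tnth (est x) i)).
Proof.
move=> [mest _]; apply: measurableT_comp => //.
exact: (measurableT_comp (@measurable_tnth _ _ n i) mest).
Qed.

Lemma exp_estimator n (d : 'I_n -> n.-tuple R -> R) :
  (forall i, measurable_fun [set: n.-tuple R] (d i)) ->
  estimator (fun x => [tuple expR (d i x) | i < n]).
Proof.
move=> md; split; last by move=> x i; rewrite tnth_mktuple expR_gt0.
apply/measurable_fun_tnthP => i.
apply: (eq_measurable_fun (fun x => expR (d i x))).
  by move=> x _; rewrite /= tnth_mktuple.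
exact: measurableT_comp.
Qed.

Lemma clip_bounded n B (est : n.-tuple R -> n.-tuple R) : 0 <= B ->
  estimator est -> bounded_estimator B (clip_est B est).
Proof.
move=> B0 eest; split; last first.
  by move=> x i; rewrite tnth_mktuple expRK clip_itv.
apply: exp_estimator => i; rewrite /clip.
apply: measurable_minr => //; apply: measurable_maxr => //.
exact: measurable_ln_est.
Qed.

Lemma geomean_bounded n B s (e1 e2 : n.-tuple R -> n.-tuple R) : 0 <= s <= 1 ->
  bounded_estimator B e1 -> bounded_estimator B e2 ->
  bounded_estimator B (geomean_est s e1 e2).
Proof.
move=> s01 [ee1 b1] [ee2 b2]; split.
  apply: exp_estimator => i; apply: measurable_funD; apply: measurable_funM => //;
  exact: measurable_ln_est.
move=> x i; rewrite tnth_mktuple expRK.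
by have := b1 x i; have := b2 x i; move: s01 => /andP[? ?] /andP[? ?] /andP[? ?]; nra.
Qed.

Lemma risk_geomean n B s (e1 e2 : n.-tuple R -> n.-tuple R) (mu : n.-tuple R) :
  0 <= s <= 1 ->
  bounded_estimator B e1 -> bounded_estimator B e2 -> (forall i, 0 < tnth mu i) ->
  (risk (geomean_est s e1 e2) mu <= (1 - s)%:E * risk e1 mu + s%:E * risk e2 mu)%E.
Proof.
move=> s01 b1 b2 mu0; have [eg _] := geomean_bounded s01 b1 b2.
case: b1 b2 => [ee1 _] [ee2 _]; have /andP[s0 s1] := s01.
have s10 : 0 <= 1 - s by rewrite subr_ge0.
have l0 (e : n.-tuple R -> n.-tuple R) x :
    (0 <= (n%:R^-1 * \sum_(i < n) loss e mu i x)%:E)%E.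
  by rewrite lee_fin mulr_ge0// sumr_ge0// => i _; exact: sqr_ge0.
have ml (e : n.-tuple R -> n.-tuple R) : estimator e ->
    measurable_fun [set: n.-tuple R] (fun x => (n%:R^-1 * \sum_(i < n) loss e mu i x)%:E).
  by move=> ee; apply/measurable_EFinP; exact: measurable_avg_loss.
rewrite /risk -!exp_expectZ//; [|exact: ml|exact: l0|exact: ml|exact: l0].
rewrite -exp_expectD//; last 4 first.
- by apply: measurable_funeM; exact: ml.
- by apply: measurable_funeM; exact: ml.
- by move=> x; apply: mule_ge0; [rewrite lee_fin|exact: l0].
- by move=> x; apply: mule_ge0; [rewrite lee_fin|exact: l0].
apply: exp_expect_le => //.
- exact: ml.
- by apply: emeasurable_funD; apply: measurable_funeM; exact: ml.
- by move=> x; exact: l0.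
- move=> x; rewrite -!EFinM -EFinD lee_fin !mulrA ![_ * n%:R^-1]mulrC -!mulrA -mulrDr.
  rewrite ler_wpM2l// !mulr_sumr -big_split/=; apply: ler_sum => i _.
  rewrite tnth_mktuple expRK.
  move: (ln _) (ln (tnth (e2 x) i)) (ln (tnth mu i)) => a b c.
  have : 0 <= (1 - s) * s * (a - b) ^+ 2 by apply: mulr_ge0; [exact: mulr_ge0|exact: sqr_ge0].
  nra.
Qed.

Lemma risk_bounded n B (est : n.-tuple R -> n.-tuple R) (mu : n.-tuple R) :
  0 <= B -> bounded_estimator B est ->
  (forall i, 1 <= tnth mu i) -> (forall i, ln (tnth mu i) <= B) ->
  exists2 a, risk est mu = a%:E & 0 <= a <= B ^+ 2.
Proof.
move=> B0 best mu1 muB; have [eest _] := best.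
apply: exp_expect_bounded.
- by move=> i; exact: lt_le_trans (mu1 i).
- exact: measurable_avg_loss.
- by move=> x; apply: avg_loss_bounded => // i; rewrite muB ln_ge0.
Qed.

Lemma minimax_risk_ge0 n : (0 <= minimax_risk n p eta)%E.
Proof. by apply: le_ereal_inf_tmp => _ [est _ <-]; exact: max_risk_ge0. Qed.

Lemma minimax_risk_le n (est : n.-tuple R -> n.-tuple R) : estimator est ->
  (minimax_risk n p eta <= max_risk p eta est)%E.
Proof. by move=> eest; apply: ereal_inf_lbound; exists est. Qed.

Lemma minimax_risk_fin n : minimax_risk n p eta = (fine (minimax_risk n p eta))%:E.
Proof.
rewrite fineK// ge0_fin_numE ?minimax_risk_ge0//.
apply: (le_lt_trans (minimax_risk_le (thresh_estimator n ltr01))).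
by rewrite (le_lt_trans (max_risk_thresh_bound _ _ _ _)) ?ltry.
Qed.

Lemma grid_round (h B : R) (K : nat) (m : R) : 0 < h -> B <= K%:R * h -> 1 <= m -> ln m <= B ->
  exists k : 'I_K.+1, expR (k%:R * h) <= m <= expR h * expR (k%:R * h).
Proof.
move=> h0 BK m1 mB; have l0 : 0 <= ln m by exact: ln_ge0.
have m0 : 0 < m by exact: lt_le_trans m1.
have /andP[k1 k2] := @truncn_itv R (ln m / h) (divr_ge0 l0 (ltW h0)).
have kK : (Num.truncn (ln m / h) < K.+1)%N.
  rewrite ltnS -(ler_nat R); apply: (le_trans k1).
  by rewrite ler_pdivrMr// (le_trans mB).
exists (Ordinal kK); rewrite -expRD /=.
move: k1 k2; rewrite ler_pdivlMr// ltr_pdivrMr// -natr1 => k1 k2.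
by apply/andP; split; rewrite -ler_ln ?posrE ?expR_gt0// expRK; lra.
Qed.

(* Bounded estimators are tested on a finite grid, where the convexity of the
   loss makes the minimax theorem elementary; rounding down keeps the grid
   points in the parameter set. *)
Lemma least_favorable_prior n (v : R) : (v%:E < minimax_risk n p eta)%E ->
  exists (I : finType) (pt : I -> n.-tuple R) (pi : I -> R),
  [/\ forall i, Mset p eta (pt i), forall i, 0 <= pi i, \sum_i pi i = 1 &
    forall est : n.-tuple R -> n.-tuple R, estimator est ->
      (v%:E <= \sum_i (pi i)%:E * risk est (pt i))%E].
Proof.
rewrite minimax_risk_fin lte_fin; set w := fine _ => vw.
pose B := (n%:R * eta `^ p) `^ p^-1 + 1.
have B0 : 0 < B by rewrite ltr_wpDl// powR_ge0.
have MB mu : @Mset R n p eta mu -> forall i, ln (tnth mu i) <= B.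
  by move=> Mmu i; rewrite (le_trans (Mset_ln_le Mmu i))// /B lerDl.
(* [D0] dominates the coefficient of [h] in [risk_round], so the grid step [h] keeps the rounding
   error within a third of the gap [w - v]. *)
pose D0 := 2 * B + B ^+ 2 * n%:R + 1.
have D00 : 0 < D0.
  by rewrite ltr_wpDl// addr_ge0// mulr_ge0// ?sqr_ge0// ltW.
pose h := (w - v) / 3 / D0.
have h0 : 0 < h by rewrite !divr_gt0// subr_gt0.
pose K := (Num.truncn (B / h)).+1.
have BK : B <= K%:R * h.
  rewrite -ler_pdivrMr//.
  have /andP[_ /ltW] := @truncn_itv R (B / h) (divr_ge0 (ltW B0) (ltW h0)).
  by [].
pose pt0 (k : {ffun 'I_n -> 'I_K.+1}) : n.-tuple R := [tuple expR ((k i)%:R * h) | i < n].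
(* Grid points outside the parameter set are redirected to the all-ones vector, so that every index
   gives an admissible parameter. *)
pose pt k := if `[< @Mset R n p eta (pt0 k) >] then pt0 k else [tuple (1:R) | i < n].
have Mpt k : Mset p eta (pt k).
  by rewrite /pt; case: asboolP => // _; exact: Mset_ones.
have pt1 k i : 1 <= tnth (pt k) i by have [] := Mpt k.
have rounding mu : @Mset R n p eta mu -> exists k,
    forall i, tnth (pt k) i <= tnth mu i <= expR h * tnth (pt k) i.
  move=> Mmu; have [mu1 hmu] := Mmu.
  have /choice[k hk] i := grid_round h0 BK (mu1 i) (MB _ Mmu i).
  exists (finfun k) => i; suff -> : pt (finfun k) = pt0 (finfun k).
    by rewrite tnth_mktuple ffunE hk.
  rewrite /pt ifT//; apply/asboolP; split.
    by move=> j; rewrite tnth_mktuple -expR0 ler_expR mulr_ge0// ltW.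
  apply: le_trans hmu; rewrite ler_wpM2l// ler_sum// => j _.
  rewrite tnth_mktuple ffunE expRK; have /andP[hj _] := hk j.
  have kh0 : 0 <= (k j)%:R * h by rewrite mulr_ge0// ltW.
  apply: ge0_ler_powR; rewrite ?nnegrE ?(ltW p0)// ?ln_ge0//.
  by rewrite -[leLHS]expRK ler_ln// posrE ?expR_gt0// (lt_le_trans ltr01).
have ptB k i : ln (tnth (pt k) i) <= B by exact: MB.
have rfin est k : bounded_estimator B est ->
    exists2 a, risk est (pt k) = a%:E & 0 <= a <= B ^+ 2.
  by move=> best; apply: risk_bounded => //; exact: ltW.
pose r est k := fine (risk est (pt k)).
have rE est k : bounded_estimator B est -> risk est (pt k) = (r est k)%:E.
  by move=> /rfin-/(_ k)[a]; rewrite /r => ->.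
(* The gap [w - v] is split into thirds: some parameter has risk above [v + 2 (w - v) / 3], rounding
   loses one third, and the last one separates [v'] from [v]. *)
have [|||||pi [pi0 pi1 hpi]] := @finite_minimax R _ (n.-tuple R -> n.-tuple R)
  [set est | bounded_estimator B est] r (B ^+ 2) v (v + (w - v) / 3).
- by rewrite ltrDl divr_gt0// subr_gt0.
- exists (clip_est B (@thresh_est R n 1)); apply: clip_bounded; first exact: ltW.
  exact: thresh_estimator.
- by move=> est k /(rfin est k)[a]; rewrite /r => ->.
- move=> e1 e2 s b1 b2 s01; exists (geomean_est s e1 e2).
    exact: geomean_bounded.
  move=> k; have bg := geomean_bounded s01 b1 b2.
  have := risk_geomean s01 b1 b2 (fun i => lt_le_trans ltr01 (pt1 k i)).
  by rewrite !rE// -!EFinM -EFinD lee_fin.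
- move=> est best; have [eest _] := best.
  have : (w%:E <= max_risk p eta est)%E.
    by rewrite /w -minimax_risk_fin; exact: minimax_risk_le.
  have w2 : ((v + 2 * ((w - v) / 3))%:E < w%:E)%E by rewrite lte_fin; lra.
  move=> /(lt_le_trans w2) /ereal_sup_gt[_ [mu Mmu <-]] hmu.
  have [k hk] := rounding mu Mmu; exists k.
  have := risk_round (ltW B0) (ltW h0) best (pt1 k) (MB _ Mmu) hk.
  rewrite rE// => /(lt_le_trans hmu); rewrite -EFinD lte_fin => hr.
  have : (2 * B + B ^+ 2 * n%:R) * h <= (w - v) / 3.
    rewrite /h mulrCA -[leRHS]mulr1 ler_wpM2l ?divr_ge0 ?subr_ge0 ?(ltW vw)//.
    by rewrite ler_pdivrMr// mul1r /D0 lerDl.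
  lra.
exists {ffun 'I_n -> 'I_K.+1}, pt, pi; split=> // est eest.
(* Clipping reduces the loss pointwise because the support points have logarithms in [[0, B]]; the
   bound thus extends from bounded estimators to all. *)
have bc := clip_bounded (ltW B0) eest.
apply: (@le_trans _ _ (\sum_i (pi i)%:E * risk (clip_est B est) (pt i))%E).
  under eq_bigr do rewrite rE// -EFinM.
  by rewrite sumEFin lee_fin; exact: hpi.
apply: lee_sum => k _; rewrite lee_wpmul2l ?lee_fin//.
apply: risk_le => //; first by case: bc.
  by move=> i; exact: lt_le_trans (pt1 k i).
move=> x i; rewrite /loss tnth_mktuple expRK; apply: clip_dist.
by rewrite ptB ln_ge0.
Qed.

(** * Estimators on concatenated samples *)

Section cat.
Variables (n m : nat) (est : (n + m).-tuple R -> (n + m).-tuple R).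
Hypothesis eest : estimator est.
Hypotheses (n0 : (0 < n)%N) (m0 : (0 < m)%N).

(** The data [y] of the second block come first as a frozen argument: each [est_left y] is an
    estimator for the first block alone, to which a Bayes bound applies. *)
Definition est_left (y : m.-tuple R) (x : n.-tuple R) : n.-tuple R :=
  [tuple tnth (est (cat_tuple x y)) (lshift m i) | i < n].

Definition est_right (x : n.-tuple R) (y : m.-tuple R) : m.-tuple R :=
  [tuple tnth (est (cat_tuple x y)) (rshift n i) | i < m].

Lemma measurable_cat_tuple : measurable_fun [set: n.-tuple R * m.-tuple R]
  (fun z => (cat_tuple z.1 z.2 : (n + m).-tuple R)).
Proof.
apply/measurable_fun_tnthP => i; case: (split_ordP i) => j ->.
  apply: (eq_measurable_fun (fun z : n.-tuple R * m.-tuple R => tnth z.1 j)).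
    by move=> z _ /=; rewrite tnth_lshift.
  exact: (measurableT_comp (@measurable_tnth _ _ n j) measurable_fst).
apply: (eq_measurable_fun (fun z : n.-tuple R * m.-tuple R => tnth z.2 j)).
  by move=> z _ /=; rewrite tnth_rshift.
exact: (measurableT_comp (@measurable_tnth _ _ m j) measurable_snd).
Qed.

Lemma measurable_est_cat i : measurable_fun [set: n.-tuple R * m.-tuple R]
  (fun z => tnth (est (cat_tuple z.1 z.2)) i).
Proof.
case: eest => mest _.
apply: (measurableT_comp (@measurable_tnth _ _ _ i)).
by apply: (measurableT_comp mest); exact: measurable_cat_tuple.
Qed.

Lemma estimator_left y : estimator (est_left y).
Proof.
split; last by move=> x i; rewrite tnth_mktuple; case: eest => _; exact.
apply/measurable_fun_tnthP => i.
apply: (eq_measurable_fun (fun x => tnth (est (cat_tuple x y)) (lshift m i))).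
  by move=> x _ /=; rewrite tnth_mktuple.
exact: (measurableT_comp (measurable_est_cat _) (measurable_pair2 y)).
Qed.

Lemma estimator_right x : estimator (est_right x).
Proof.
split; last by move=> y i; rewrite tnth_mktuple; case: eest => _; exact.
apply/measurable_fun_tnthP => i.
apply: (eq_measurable_fun (fun y => tnth (est (cat_tuple x y)) (rshift n i))).
  by move=> y _ /=; rewrite tnth_mktuple.
exact: (measurableT_comp (measurable_est_cat _) (measurable_pair1 x)).
Qed.

Lemma risk_mul k (e : k.-tuple R -> k.-tuple R) mu : (0 < k)%N -> estimator e ->
  (forall i, 0 < tnth mu i) ->
  (k%:R%:E * risk e mu = exp_expect mu (fun x => \sum_(i < k) (loss e mu i x)%:E))%E.
Proof.
move=> k0 ee mu0; rewrite risk_sum// muleA -EFinM divff ?pnatr_eq0 -?lt0n// mul1e.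
rewrite exp_expect_sum//.
- by move=> i; apply/measurable_EFinP; exact: measurable_loss.
- by move=> i x; rewrite lee_fin sqr_ge0.
Qed.

Lemma measurable_loss_left mu i : measurable_fun [set: n.-tuple R * m.-tuple R]
  (fun z => (loss (est_left z.2) mu i z.1)%:E).
Proof.
apply/measurable_EFinP; apply: measurable_funX; apply: measurable_funB => //.
apply: measurableT_comp => //.
apply: (eq_measurable_fun (fun z : n.-tuple R * m.-tuple R => tnth (est (cat_tuple z.1 z.2)) (lshift m i))).
  by move=> x _ /=; rewrite tnth_mktuple.
exact: measurable_est_cat.
Qed.

Lemma measurable_loss_right nu i : measurable_fun [set: n.-tuple R * m.-tuple R]
  (fun z => (loss (est_right z.1) nu i z.2)%:E).
Proof.
apply/measurable_EFinP; apply: measurable_funX; apply: measurable_funB => //.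
apply: measurableT_comp => //.
apply: (eq_measurable_fun (fun z : n.-tuple R * m.-tuple R => tnth (est (cat_tuple z.1 z.2)) (rshift n i))).
  by move=> x _ /=; rewrite tnth_mktuple.
exact: measurable_est_cat.
Qed.

Lemma measurable_risk_left mu : (forall i, 0 < tnth mu i) ->
  measurable_fun [set: m.-tuple R] (fun y => n%:R%:E * risk (est_left y) mu)%E.
Proof.
move=> mu0.
apply: (eq_measurable_fun
  (fun y => exp_expect mu (fun x => \sum_(i < n) (loss (est_left y) mu i x)%:E)%E)).
  by move=> y _; rewrite risk_mul//; exact: estimator_left.
apply: (measurable_exp_expect (f := fun z : m.-tuple R * n.-tuple R =>
  (\sum_(i < n) (loss (est_left z.1) mu i z.2)%:E)%E)) => //.
  have ms : measurable_fun [set: m.-tuple R * n.-tuple R] (fun z => (z.2, z.1)).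
    exact: measurable_swap.
  apply: emeasurable_sum => i.
  exact: (measurableT_comp (measurable_loss_left mu i) ms).
by move=> z; apply: sume_ge0 => i _; rewrite lee_fin sqr_ge0.
Qed.

Lemma measurable_risk_right nu : (forall i, 0 < tnth nu i) ->
  measurable_fun [set: n.-tuple R] (fun x => m%:R%:E * risk (est_right x) nu)%E.
Proof.
move=> nu0.
apply: (eq_measurable_fun
  (fun x => exp_expect nu (fun y => \sum_(i < m) (loss (est_right x) nu i y)%:E)%E)).
  by move=> x _; rewrite risk_mul//; exact: estimator_right.
apply: (measurable_exp_expect (f := fun z : n.-tuple R * m.-tuple R =>
  (\sum_(i < m) (loss (est_right z.1) nu i z.2)%:E)%E)) => //.
  by apply: emeasurable_sum => i; exact: measurable_loss_right.
by move=> z; apply: sume_ge0 => i _; rewrite lee_fin sqr_ge0.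
Qed.

(** The loss is a sum over coordinates and splits between the blocks. The left part needs
    [exp_expect_swap], since the first block must be integrated innermost to recover the risk of
    [est_left]. *)
Lemma risk_cat (mu : n.-tuple R) (nu : m.-tuple R) :
  (forall i, 0 < tnth mu i) -> (forall i, 0 < tnth nu i) ->
  ((n + m)%:R%:E * risk est (cat_tuple mu nu) =
   exp_expect nu (fun y => n%:R%:E * risk (est_left y) mu) +
   exp_expect mu (fun x => m%:R%:E * risk (est_right x) nu))%E.
Proof.
move=> mu0 nu0.
have cat0 i : 0 < tnth (cat_tuple mu nu) i.
  by case: (split_ordP i) => j ->; rewrite ?tnth_lshift ?tnth_rshift.
have l0 k (e : k.-tuple R -> k.-tuple R) xi i x : (0 <= (loss e xi i x)%:E)%E.
  by rewrite lee_fin sqr_ge0.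
pose A (z : n.-tuple R * m.-tuple R) := (\sum_(i < n) (loss (est_left z.2) mu i z.1)%:E)%E.
pose C (z : n.-tuple R * m.-tuple R) := (\sum_(i < m) (loss (est_right z.1) nu i z.2)%:E)%E.
have A0 z : (0 <= A z)%E by apply: sume_ge0.
have C0 z : (0 <= C z)%E by apply: sume_ge0.
have mA : measurable_fun [set: n.-tuple R * m.-tuple R] A.
  by apply: emeasurable_sum => i; exact: measurable_loss_left.
have mC : measurable_fun [set: n.-tuple R * m.-tuple R] C.
  by apply: emeasurable_sum => i; exact: measurable_loss_right.
rewrite risk_mul ?addn_gt0 ?n0// exp_expect_cat.
transitivity (exp_expect mu (fun x => exp_expect nu (fun y => A (x, y)) +
                                      exp_expect nu (fun y => C (x, y))))%E.
  congr (exp_expect _ _); apply/funext => x; rewrite -exp_expectD//.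
  - congr (exp_expect _ _); apply/funext => y; rewrite big_split_ord/=.
    by congr (_ + _)%E; apply: eq_bigr => i _; rewrite /loss tnth_mktuple ?tnth_lshift ?tnth_rshift.
  - exact: (measurableT_comp mA (measurable_pair1 x)).
  - exact: (measurableT_comp mC (measurable_pair1 x)).
rewrite exp_expectD//.
- congr (_ + _)%E.
    rewrite exp_expect_swap//; congr (exp_expect _ _); apply/funext => y.
    by rewrite risk_mul//; exact: estimator_left.
  congr (exp_expect _ _); apply/funext => x.
  by rewrite risk_mul//; exact: estimator_right.
- exact: measurable_exp_expect.
- exact: measurable_exp_expect.
- by move=> x; exact: exp_expect_ge0.
- by move=> x; exact: exp_expect_ge0.
Qed.

End cat.

End minimax_prior.

(** * Superadditivity and a lower bound for the minimax risk *)

Section minimax_bounds.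
Context {R : realType}.
Variables (p eta : R).
Hypothesis p0 : 0 < p.

Lemma exp_expect_mix_ge n (nu : n.-tuple R) (I : finType) (pi : I -> R)
    (g : I -> n.-tuple R -> \bar R) (u : R) :
  (forall i, 0 < tnth nu i) -> (forall i, 0 <= pi i) ->
  (forall i, measurable_fun [set: n.-tuple R] (g i)) -> (forall i x, 0 <= g i x)%E ->
  0 <= u -> (forall x, u%:E <= \sum_i (pi i)%:E * g i x)%E ->
  (u%:E <= \sum_i (pi i)%:E * exp_expect nu (g i))%E.
Proof.
move=> nu0 pi0 mg g0 u0 hu.
have mpg i : measurable_fun [set: n.-tuple R] (fun x => (pi i)%:E * g i x)%E.
  exact: measurable_funeM.
have pg0 i x : (0 <= (pi i)%:E * g i x)%E by rewrite mule_ge0// lee_fin.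
under eq_bigr do rewrite -exp_expectZ//.
rewrite -exp_expect_sum// -(exp_expect_cst nu0 u0).
apply: exp_expect_le => //.
exact: emeasurable_sum.
Qed.

Lemma sum_weightZ (I : finType) (pi : I -> R) (x : \bar R) :
  (forall i, 0 <= pi i) -> \sum_i pi i = 1 -> (\sum_i (pi i)%:E * x = x)%E.
Proof.
move=> pi0 pi1; rewrite -ge0_sume_distrl//; last by move=> i _; rewrite lee_fin.
by rewrite sumEFin pi1 mul1e.
Qed.

Lemma minimax_risk_cat_ge n m (v v' : R) : (0 < n)%N -> (0 < m)%N ->
  (v%:E < minimax_risk n p eta)%E -> (v'%:E < minimax_risk m p eta)%E ->
  n%:R * v + m%:R * v' <= (n + m)%:R * fine (minimax_risk (n + m) p eta).
Proof.
move=> n0 m0 hv hv'.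
have [I [pt [pi [Mpt pi0 pi1 hpi]]]] := least_favorable_prior p0 hv.
have [J [qt [rho [Mqt rho0 rho1 hrho]]]] := least_favorable_prior p0 hv'.
pose u := Num.max v 0; pose u' := Num.max v' 0.
have u0 : 0 <= u by rewrite le_max lexx orbT.
have u'0 : 0 <= u' by rewrite le_max lexx orbT.
have nm0 : 0 < (n + m)%:R :> R by rewrite ltr0n addn_gt0 n0.
have ptp i := Mset_gt0 (Mpt i); have qtp j := Mset_gt0 (Mqt j).
suff H : n%:R * u + m%:R * u' <= (n + m)%:R * fine (minimax_risk (n + m) p eta).
  apply: le_trans H; apply: lerD; apply: ler_wpM2l => //.
    by rewrite le_max lexx.
  by rewrite le_max lexx.
rewrite [leRHS]mulrC -ler_pdivrMr// -lee_fin -minimax_risk_fin//.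
apply: le_ereal_inf_tmp => _ [est eest <-].
rewrite EFinM lee_pdivrMr// muleC.
set W := max_risk p eta est.
apply: (@le_trans _ _ (\sum_i (pi i)%:E * \sum_j (rho j)%:E *
   ((n + m)%:R%:E * risk est (cat_tuple (pt i) (qt j))))%E); last first.
  rewrite -[leRHS](sum_weightZ _ pi0 pi1); apply: lee_sum => i _.
  rewrite lee_wpmul2l ?lee_fin// -[leRHS](sum_weightZ _ rho0 rho1).
  apply: lee_sum => j _; rewrite lee_wpmul2l ?lee_fin// lee_wpmul2l ?lee_fin//.
  by apply: max_risk_ub; exact: Mset_cat.
pose a i j := exp_expect (qt j) (fun y => n%:R%:E * risk (est_left est y) (pt i))%E.
pose b i j := exp_expect (pt i) (fun x => m%:R%:E * risk (est_right est x) (qt j))%E.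
have nr0 i y : (0 <= n%:R%:E * risk (est_left est y) (pt i))%E.
  by rewrite mule_ge0 ?lee_fin// risk_ge0.
have mr0 j x : (0 <= m%:R%:E * risk (est_right est x) (qt j))%E.
  by rewrite mule_ge0 ?lee_fin// risk_ge0.
have a0 i j : (0 <= a i j)%E by exact: exp_expect_ge0.
have b0 i j : (0 <= b i j)%E by exact: exp_expect_ge0.
(* The Bayes bound of [pi] holds for each frozen [y] and is then averaged under [qt j]; [Hb] is the
   mirror image. *)
have Ha j : ((n%:R * u)%:E <= \sum_i (pi i)%:E * a i j)%E.
  apply: exp_expect_mix_ge => //.
  - by move=> i; exact: measurable_risk_left.
  - by rewrite mulr_ge0.
  - move=> y; under eq_bigr do rewrite muleCA.
    rewrite -ge0_sume_distrr; last by move=> i _; rewrite mule_ge0 ?lee_fin ?risk_ge0.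
    rewrite EFinM lee_wpmul2l ?lee_fin//.
    rewrite /u; case: (leP v 0) => v0.
      by apply: sume_ge0 => i _; rewrite mule_ge0 ?lee_fin ?risk_ge0.
    by apply: hpi; exact: estimator_left.
have Hb i : ((m%:R * u')%:E <= \sum_j (rho j)%:E * b i j)%E.
  apply: exp_expect_mix_ge => //.
  - by move=> j; exact: measurable_risk_right.
  - by rewrite mulr_ge0.
  - move=> y; under eq_bigr do rewrite muleCA.
    rewrite -ge0_sume_distrr; last by move=> j _; rewrite mule_ge0 ?lee_fin ?risk_ge0.
    rewrite EFinM lee_wpmul2l ?lee_fin//.
    rewrite /u'; case: (leP v' 0) => v0.
      by apply: sume_ge0 => j _; rewrite mule_ge0 ?lee_fin ?risk_ge0.
    by apply: hrho; exact: estimator_right.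
rewrite (eq_bigr (fun i => (pi i)%:E * (\sum_j (rho j)%:E * a i j) +
                           (pi i)%:E * (\sum_j (rho j)%:E * b i j))%E); last first.
  move=> i _; rewrite -ge0_muleDr; last 2 first.
  - by apply: sume_ge0 => j _; rewrite mule_ge0// lee_fin.
  - by apply: sume_ge0 => j _; rewrite mule_ge0// lee_fin.
  congr (_ * _)%E; rewrite -big_split/=; apply: eq_bigr => j _.
  by rewrite risk_cat// -/(a i j) -/(b i j) ge0_muleDr.
rewrite big_split/= EFinD; apply: leeD; last first.
  rewrite -[leLHS](sum_weightZ _ pi0 pi1); apply: lee_sum => i _.
  by apply: lee_wpmul2l; [rewrite lee_fin|exact: Hb].
have ra0 i j : (0 <= (rho j)%:E * a i j)%E by rewrite mule_ge0// lee_fin.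
under eq_bigr do rewrite ge0_sume_distrr//.
rewrite exchange_big/= -[leLHS](sum_weightZ _ rho0 rho1); apply: lee_sum => j _.
under eq_bigr do rewrite muleCA.
rewrite -ge0_sume_distrr; last by move=> i _; rewrite mule_ge0// lee_fin.
by apply: lee_wpmul2l; [rewrite lee_fin|exact: Ha].
Qed.

Lemma minimax_risk_superadditive n m : (0 < n)%N -> (0 < m)%N ->
  n%:R * fine (minimax_risk n p eta) + m%:R * fine (minimax_risk m p eta) <=
  (n + m)%:R * fine (minimax_risk (n + m) p eta).
Proof.
move=> n0 m0; set a := fine (minimax_risk n p eta); set b := fine (minimax_risk m p eta).
set c := fine _; rewrite leNgt; apply/negP => h.
have nm0 : 0 < (n + m)%:R :> R by rewrite ltr0n addn_gt0 n0.
(* Lowering both minimax risks by [e] consumes half of the assumed deficit, which leaves a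
   contradiction. *)
pose e := (n%:R * a + m%:R * b - (n + m)%:R * c) / (2 * (n + m)%:R).
have e0 : 0 < e by rewrite divr_gt0 ?subr_gt0// mulr_gt0.
have ha : ((a - e)%:E < minimax_risk n p eta)%E.
  by rewrite minimax_risk_fin// lte_fin -/a ltrBlDr ltrDl.
have hb : ((b - e)%:E < minimax_risk m p eta)%E.
  by rewrite minimax_risk_fin// lte_fin -/b ltrBlDr ltrDl.
have := minimax_risk_cat_ge n0 m0 ha hb; rewrite -/c.
have : e * (2 * (n + m)%:R) = n%:R * a + m%:R * b - (n + m)%:R * c.
  by rewrite divfK// gt_eqF// mulr_gt0.
by move: h; rewrite natrD; lra.
Qed.

End minimax_bounds.

Section lower_bound.
Context {R : realType}.
Variables (p eta : R).
Hypothesis p0 : 0 < p.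
Local Notation leb := (@lebesgue_measure R).

Definition spike n (a : R) (i : 'I_n) : n.-tuple R := [tuple if j == i then a else 1 | j < n].

Lemma Mset_spike n th i : 0 <= th -> th `^ p <= n%:R * eta `^ p ->
  Mset p eta (@spike n (expR th) i).
Proof.
move=> th0 hth; have n0 : (0 < n)%N by exact: leq_ltn_trans (ltn_ord i).
apply/MsetP => //; split.
  by move=> j; rewrite tnth_mktuple; case: ifP => // _; rewrite -expR0 ler_expR.
apply: le_trans hth; rewrite (bigD1 i)//= tnth_mktuple eqxx expRK.
rewrite big1 ?addr0// => j ji.
by rewrite tnth_mktuple (negbTE ji) ln1 powR0// gt_eqF.
Qed.

Lemma sume_const (I : finType) (A : {pred I}) (x : \bar R) :
  (\sum_(i in A) x = #|A|%:R%:E * x)%E.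
Proof.
rewrite -sumr_const -sumEFin ge0_sume_distrl//.
by apply: eq_bigr => i _; rewrite mul1e.
Qed.

Lemma measurable_le_cst (c : R) : measurable_fun [set: R] (fun x : R => (x <= c)%R%:R : R).
Proof.
rewrite (_ : (fun _ => _) = \1_`]-oo, c]); first exact: measurable_indic.
by apply/funext => x; rewrite indicE mem_setE in_itv.
Qed.

(** The two laws differ in coordinates [i] and [j] only. The likelihood ratio is at least [a^-1] in
    coordinate [i], and at least [a expR (- (K a))] in coordinate [j] while the observation stays
    below [K a]. The factors [a^-1] and [a] cancel. *)
Lemma exp_expect_spike_ge n (a K : R) (i j : 'I_n) (f : n.-tuple R -> \bar R) :
  i != j -> 1 <= a -> measurable_fun [set: n.-tuple R] f -> (forall x, 0 <= f x)%E ->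
  (exp_expect (spike a j)
     (fun x => (expR (- (K * a)) * (tnth x j <= K * a)%R%:R)%:E * f x) <=
   exp_expect (spike a i) f)%E.
Proof.
move=> ij a1 mf f0; have a0 : 0 < a by exact: lt_le_trans a1.
have sp0 k l : 0 < tnth (@spike n a k) l.
  by rewrite tnth_mktuple; case: ifP.
pose w (k : 'I_n) (x : R) := if k == i then a^-1
  else if k == j then a * (expR (- (K * a)) * (x <= K * a)%R%:R) else 1.
have w0 k x : 0 <= w k x.
  rewrite /w; case: ifP => _; first by rewrite invr_ge0 ltW.
  by case: ifP => // _; rewrite !mulr_ge0 ?expR_ge0// ltW.
have mw k : measurable_fun [set: R] (w k).
  rewrite /w; case: (k == i) => //; case: (k == j) => //.
  apply: measurable_funM => //; apply: measurable_funM => //.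
  exact: measurable_le_cst.
have hw k x : w k x * exponential_pdf (tnth (@spike n a j) k)^-1 x <=
    exponential_pdf (tnth (@spike n a i) k)^-1 x.
  have [x0|x0] := ltP x 0; first by rewrite !lt0_exponential_pdf ?mulr0.
  have xax : a^-1 * x <= x by rewrite ler_piMl// invf_le1.
  rewrite !exponential_pdfE// !tnth_mktuple /w; case: (eqVneq k i) => [->|ki].
    rewrite (negbTE ij) invr1 mulN1r mul1r ler_wpM2l ?invr_ge0 ?(ltW a0)//.
    by rewrite ler_expR mulNr lerN2.
  case: (eqVneq k j) => [_|_]; last by rewrite mul1r.
  case: (leP x (K * a)) => xK /=; last first.
    by rewrite !mulr0 mul0r mulr_ge0 ?expR_ge0// invr1.
  rewrite mulr1 invr1 mul1r mulrACA divff ?gt_eqF// mul1r -expRD ler_expR.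
  by have : 0 <= a^-1 * x by [rewrite mulr_ge0// invr_ge0 ltW]; lra.
have := exp_expect_weight (sp0 j) (sp0 i) mw w0 hw mf f0.
congr (_ <= _)%E; congr (exp_expect _ _); apply/funext => x; congr (_%:E * _)%E.
rewrite (bigD1 i)//= (bigD1 j)//=; last by rewrite eq_sym.
rewrite big1; last first.
  by move=> k /andP[ki kj]; rewrite /w (negbTE ki) (negbTE kj).
by rewrite /w !eqxx eq_sym (negbTE ij) mulr1 mulKf// gt_eqF.
Qed.

(** By scale invariance [[0, K a]] has mass [1 - expR (- K)] under mean [a], so the price of
    truncation does not depend on the spike height. *)
Lemma exp_expect_spike_itv n (a K : R) (j : 'I_n) (b : R) : 1 <= a -> 0 < K -> 0 <= b ->
  ((b * (1 - expR (- K)))%:E <= exp_expect (spike a j)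
    (fun x => (b * (tnth x j <= K * a)%R%:R)%:E))%E.
Proof.
move=> a1 K0 b0; have a0 : 0 < a by exact: lt_le_trans a1.
have sp0 l : 0 < tnth (@spike n a j) l by rewrite tnth_mktuple; case: ifP.
have mI : measurable_fun [set: R] (fun x : R => b * (x <= K * a)%R%:R).
  apply: measurable_funM => //.
  exact: measurable_le_cst.
rewrite (exp_expect_tnth _ sp0 mI); last by move=> x; rewrite mulr_ge0.
rewrite tnth_mktuple eqxx.
have pdf0 (x : R) : 0 <= exponential_pdf a^-1 x.
  by rewrite exponential_pdf_ge0// invr_ge0 ltW.
have mpdf (U : set R) : measurable_fun U (fun x : R => (exponential_pdf a^-1 x)%:E).
  by apply/measurable_EFinP/measurable_funTS; exact: measurable_exponential_pdf.
have -> : (b * (1 - expR (- K)))%:E = (\int[leb]_(x in `[0%R, (K * a)%R])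
    (b%:E * (exponential_pdf a^-1 x)%:E))%E.
  rewrite ge0_integralZl//; [|exact: mpdf|by move=> x _; rewrite lee_fin].
  have := @exponential_prob_itv0c R a^-1 (K * a) (mulr_gt0 K0 a0).
  rewrite /exponential_prob => ->.
  by rewrite mulNr [a^-1 * _]mulrC mulfK ?gt_eqF.
rewrite integral_mkcond; apply: ge0_le_integral => //.
- by move=> x _; rewrite patchE; case: ifP => // _; rewrite mule_ge0// lee_fin.
- apply/(measurable_restrictT _ _).1 => //.
  by apply: measurable_funeM; exact: mpdf.
- by apply: emeasurable_funM; [exact: mpdf|exact/measurable_EFinP].
- move=> x _; rewrite patchE; case: ifPn => [|_].
    by rewrite inE/= in_itv/= => /andP[_ ->]; rewrite mulr1 muleC.
  by rewrite mule_ge0 ?lee_fin// mulr_ge0.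
Qed.

(** The right side is minimal at [d = th / (1 + c)], with the value on the left: up to
    normalization, the Bayes risk when target [th] competes with target 0 at odds [1 : c]. *)
Lemma weighted_sq_ge (c d th : R) : 0 <= c ->
  th ^+ 2 * (c / (1 + c)) <= (d - th) ^+ 2 + c * d ^+ 2.
Proof.
move=> c0; have c1 : 0 < 1 + c by lra.
rewrite mulrA ler_pdivrMr//.
have := sqr_ge0 ((1 + c) * d - th); nra.
Qed.

(* The bound is the Bayes risk of a single spike of height [th] whose position
   is uniform; [K] truncates the spiked observation. *)
Lemma minimax_risk_ge n (th K : R) (c := (n.-1)%:R * expR (- (K * expR th))) :
  0 <= th -> 0 < K -> th `^ p <= n%:R * eta `^ p -> (0 < n)%N ->
  ((n%:R^-1 * (th ^+ 2 * (c / (1 + c)) * (1 - expR (- K))))%:E <= minimax_risk n p eta)%E.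
Proof.
move=> th0 K0 hth n0.
set X := th ^+ 2 * _ * _.
have a1 : 1 <= expR th by rewrite -expR0 ler_expR.
have c0 : 0 <= c by rewrite mulr_ge0// expR_ge0.
apply: le_ereal_inf_tmp => _ [est eest <-]; set W := max_risk p eta est.
have n0' : 0 < n%:R :> R by rewrite ltr0n.
pose sp := @spike n (expR th).
have Msp i : Mset p eta (sp i) by exact: Mset_spike.
have sp0 i := Mset_gt0 (Msp i).
rewrite mulrC EFinM lee_pdivrMr//.
have ml i j : measurable_fun [set: n.-tuple R] (fun x => (loss est (sp i) j x)%:E).
  by apply/measurable_EFinP; exact: measurable_loss.
have l0 i j x : (0 <= (loss est (sp i) j x)%:E)%E by rewrite lee_fin sqr_ge0.
pose d j (x : n.-tuple R) := ln (tnth (est x) j).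
(* For a fixed output coordinate [j], the [n.-1] spikes located elsewhere are all moved to [j]. A
   single expectation then carries the loss for target [th] and, on the truncation event, [c] times
   the loss for target 0. *)
have column j : (X%:E <= \sum_i exp_expect (sp i) (fun x => (loss est (sp i) j x)%:E))%E.
  rewrite (bigD1 j)//=.
  have md : measurable_fun [set: n.-tuple R] (fun x => (d j x ^+ 2)%:E).
    apply/measurable_EFinP; apply: measurable_funX; exact: measurable_ln_est.
  have md0 x : (0 <= (d j x ^+ 2)%:E)%E by rewrite lee_fin sqr_ge0.
  pose J (x : n.-tuple R) : R := (tnth x j <= K * expR th)%R%:R.
  have mJ : measurable_fun [set: n.-tuple R] J.
    exact: (measurableT_comp (measurable_le_cst _) (@measurable_tnth _ _ n j)).
  pose e := expR (- (K * expR th)).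
  have e0 : 0 <= e by exact: expR_ge0.
  have J0 x : 0 <= J x by [].
  have meJ : measurable_fun [set: n.-tuple R] (fun x => (e * J x)%:E * (d j x ^+ 2)%:E)%E.
    by apply: emeasurable_funM => //; apply/measurable_EFinP; exact: measurable_funM.
  have eJ0 x : (0 <= (e * J x)%:E * (d j x ^+ 2)%:E)%E.
    by rewrite mule_ge0// lee_fin mulr_ge0.
  apply: (@le_trans _ _ (exp_expect (sp j) (fun x => (loss est (sp j) j x)%:E) +
     (n.-1)%:R%:E * exp_expect (sp j) (fun x => (e * J x)%:E * (d j x ^+ 2)%:E))%E); last first.
    apply: leeD => //.
    rewrite (_ : (n.-1)%:R%:E * _ = \sum_(i < n | i != j)
        exp_expect (sp j) (fun x => (e * J x)%:E * (d j x ^+ 2)%:E))%E; last first.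
      have nE : n.-1 = #|predC1 j| by rewrite cardC1 card_ord.
      by rewrite nE -sume_const; exact: eq_bigl.
    apply: lee_sum => i ij.
    apply: (le_trans (exp_expect_spike_ge _ ij a1 md md0)).
    rewrite le_eqVlt; apply/orP; left; apply/eqP; congr (exp_expect _ _).
    apply/funext => x; rewrite /loss tnth_mktuple eq_sym (negbTE ij) ln1 subr0.
    by [].
  rewrite -exp_expectZ// -exp_expectD//; last 2 first.
  - exact: measurable_funeM.
  - by move=> x; rewrite mule_ge0// lee_fin.
  apply: le_trans (exp_expect_spike_itv j a1 K0 _) _.
    by rewrite mulr_ge0 ?sqr_ge0// divr_ge0// addr_ge0.
  apply: exp_expect_le => //.
  - by apply/measurable_EFinP; apply: measurable_funM.
  - by apply: emeasurable_funD => //; apply: measurable_funeM.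
  - by move=> x; rewrite lee_fin !mulr_ge0 ?sqr_ge0// ?invr_ge0 ?addr_ge0.
  - move=> x; rewrite -!EFinM -EFinD lee_fin /loss tnth_mktuple eqxx expRK -/(d j x) -/(J x).
    have := weighted_sq_ge (d j x) th c0.
    rewrite /J; case: (tnth x j <= _).
      by rewrite /= !mulr1 [X in _ -> _ <= _ + X]mulrA.
    by rewrite !(mulr0, mul0r) addr0 sqr_ge0.
(* Exchanging the sums turns columns into risks: each of the [n] positions has total loss at most
   [n W], whence [X <= n W]. *)
have : (\sum_(j < n) X%:E <= \sum_(i < n) n%:R%:E * W)%E.
  apply: (@le_trans _ _ (\sum_(j < n) \sum_(i < n) exp_expect (sp i) (fun x => (loss est (sp i) j x)%:E))%E).
    by apply: lee_sum => j _; exact: column.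
  rewrite exchange_big/=; apply: lee_sum => i _.
  rewrite -exp_expect_sum// -risk_mul//.
  by rewrite lee_wpmul2l ?lee_fin//; exact: max_risk_ub.
rewrite !sume_const card_ord lee_pmul2l ?lte_fin//.
by rewrite muleC.
Qed.

End lower_bound.

(** * Small parameter sets *)

Section asymptotics.
Context {R : realType}.
Variable p : R.
Hypotheses (p0 : 0 < p) (p2 : p < 2).

Definition thresh_limit (eta t : R) : R :=
  sup [set fine (max_risk p eta (@thresh_est R n t)) | n in [set n | (0 < n)%N]].

Definition minimax_limit (eta : R) : R :=
  sup [set fine (minimax_risk n p eta) | n in [set n | (0 < n)%N]].

Lemma fine_max_risk_bound eta t n : 0 < t ->
  0 <= fine (max_risk p eta (@thresh_est R n t)) <= 18 + 2 * t.
Proof.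
move=> t0; rewrite -!lee_fin -max_risk_thresh_fin//.
by rewrite max_risk_ge0// max_risk_thresh_bound.
Qed.

Lemma fine_minimax_risk_le eta t n : 0 < t ->
  0 <= fine (minimax_risk n p eta) <= fine (max_risk p eta (@thresh_est R n t)).
Proof.
move=> t0; rewrite -!lee_fin -max_risk_thresh_fin// -minimax_risk_fin//.
by rewrite minimax_risk_ge0// minimax_risk_le//; exact: thresh_estimator.
Qed.

Lemma cvg_thresh eta t : 0 < t ->
  fine (max_risk p eta (@thresh_est R n t)) @[n --> \oo] --> thresh_limit eta t.
Proof.
move=> t0; apply: (superadditive_cvg (C := 18 + 2 * t)) => [n|n|n m n0 m0].
- by have /andP[] := fine_max_risk_bound eta n t0.
- by have /andP[] := fine_max_risk_bound eta n t0.
- exact: max_risk_thresh_superadditive.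
Qed.

Lemma cvg_minimax eta :
  fine (minimax_risk n p eta) @[n --> \oo] --> minimax_limit eta.
Proof.
apply: (superadditive_cvg (C := 18 + 2 * 1)) => [n|n|n m n0 m0].
- by have /andP[] := fine_minimax_risk_le eta n ltr01.
- have /andP[_] := fine_minimax_risk_le eta n ltr01.
  by move=> /le_trans; apply; have /andP[] := fine_max_risk_bound eta n ltr01.
- exact: minimax_risk_superadditive.
Qed.

Lemma minimax_limit_ub eta n : (0 < n)%N -> fine (minimax_risk n p eta) <= minimax_limit eta.
Proof.
move=> n0; apply: ub_le_sup; last by exists n.
exists (18 + 2 * 1) => _ [m _ <-].
have /andP[_] := fine_minimax_risk_le eta m ltr01.
by move=> /le_trans; apply; have /andP[] := fine_max_risk_bound eta m ltr01.
Qed.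

Lemma minimax_limit_ge eta n th K (c := (n.-1)%:R * expR (- (K * expR th))) :
  0 <= th -> 0 < K -> th `^ p <= n%:R * eta `^ p -> (0 < n)%N ->
  n%:R^-1 * (th ^+ 2 * (c / (1 + c)) * (1 - expR (- K))) <= minimax_limit eta.
Proof.
move=> th0 K0 hth n0; apply: le_trans (minimax_limit_ub eta n0).
by rewrite -lee_fin -minimax_risk_fin//; exact: minimax_risk_ge.
Qed.

(** A spike of height [eta] among two coordinates suffices; with [n = 1] the factor [n.-1] would
    make the lower bound vanish. *)
Lemma minimax_limit_gt0 eta : 0 < eta -> 0 < minimax_limit eta.
Proof.
move=> eta0.
have := @minimax_limit_ge eta 2 eta 1 (ltW eta0) ltr01 _ isT.
have h : eta `^ p <= 2%:R * eta `^ p.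
  by rewrite ler_peMl ?powR_ge0// ler1n.
move=> /(_ h); apply: lt_le_trans.
have e0 := expR_gt0 (- (1 * expR eta)).
rewrite mulr_gt0// ?invr_gt0// mulr_gt0//.
  by rewrite mulr_gt0 ?exprn_gt0// divr_gt0 ?mulr_gt0// addr_gt0// mulr_gt0.
Qed.

Lemma cvg_thresh_ratio eta t : 0 < eta -> 0 < t ->
  thresh_ratio p eta t n @[n --> \oo] --> (thresh_limit eta t / minimax_limit eta)%:E.
Proof.
move=> eta0 t0.
have m0 := minimax_limit_gt0 eta0.
have cB := @cvg_minimax eta.
have cAB : fine (max_risk p eta (@thresh_est R n t)) / fine (minimax_risk n p eta)
    @[n --> \oo] --> thresh_limit eta t / minimax_limit eta.
  by apply: cvgM; [exact: cvg_thresh|apply: cvgV => //; rewrite gt_eqF].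
have E : \forall n \near \oo, (fine (max_risk p eta (@thresh_est R n t)) /
    fine (minimax_risk n p eta))%:E = thresh_ratio p eta t n.
  near=> n.
  (* Extended division agrees with real division once the denominator is positive, which holds for
     large [n] because its limit is. *)
  have Bn0 : 0 < fine (minimax_risk n p eta) by near: n; exact: (cvgr_gt _ cB).
  rewrite /thresh_ratio [in RHS]minimax_risk_fin// [in RHS]max_risk_thresh_fin//.
  by rewrite inver gt_eqF// -EFinM.
apply: cvg_trans (near_eq_cvg E) _; apply: cvg_EFin => //.
exact: nearW.
Unshelve. all: by end_near.
Qed.

Lemma minimax_limit_le eta t : 0 < t -> minimax_limit eta <= thresh_limit eta t.
Proof.
move=> t0; apply: (ler_cvg_to (@cvg_minimax eta) (cvg_thresh (eta := eta) t0)).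
by near=> n; have /andP[] := fine_minimax_risk_le eta n t0.
Unshelve. all: by end_near.
Qed.

Lemma thresh_limit_le eta t C : 0 < t ->
  (forall n, max_risk p eta (@thresh_est R n t) <= C%:E)%E -> thresh_limit eta t <= C.
Proof.
move=> t0 h; apply: ge_sup; first by exists (fine (max_risk p eta (@thresh_est R 1 t))), 1%N.
by move=> _ [n _ <-]; rewrite -lee_fin -max_risk_thresh_fin.
Qed.

(** The function [th^s expR (- th)] decreases beyond [T], as [s <= 2 <= T]; the proof uses
    [ln x <= x - 1] at [x = th / T]. *)
Lemma powR_le_expR (s T th : R) : 0 <= s -> s <= 2 -> 2 <= T -> T <= th ->
  th `^ s * expR (T - th) <= T `^ s.
Proof.
move=> s0 s2 T2 Tth.
have T0 : 0 < T by lra.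
have th0 : 0 < th by lra.
rewrite /powR !gt_eqF// -expRD ler_expR.
have := @le_ln1Dx R (th / T - 1).
rewrite addrCA subrr addr0 ln_div ?posrE// => h.
have {}h : ln th - ln T <= (th - T) / T.
  rewrite mulrBl divff ?gt_eqF//; apply: h.
  by rewrite ltrBrDr addNr divr_gt0.
have h2 : s * ((th - T) / T) <= th - T.
  rewrite mulrA ler_pdivrMr// mulrC ler_wpM2l ?subr_ge0//; lra.
have h3 : s * (ln th - ln T) <= s * ((th - T) / T) by rewrite ler_wpM2l.
lra.
Qed.

Lemma powR_split (th : R) : 0 < th -> th ^+ 2 = th `^ p * th `^ (2 - p).
Proof.
move=> th0; rewrite -powRD; last by apply/implyP => _; rewrite gt_eqF.
by rewrite (_ : p + (2 - p) = 2%:R) ?powR_mulrn ?ltW//; lra.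
Qed.

(** Write [theta = ln m]. For [theta <= 1] the bound for small means applies, and [m <= e] fixes the
    exponent [t / 2e]. Above 1 the constant 18 is absorbed by [theta^p >= 1], and the missed signal
    costs [theta^p theta^(2-p)] times the probability of a miss: up to [T] this is at most
    [T^(2-p) theta^p], and beyond [T] the probability, at most [expR (T - theta)], beats the
    growth. *)
Lemma coord_risk_sparse (T m : R) (t := expR T) : 2 <= T -> 1 <= m ->
  (coord_risk t m <=
   (16 * expR (- (t / (2 * expR 1))) + (19 + T `^ (2 - p)) * ln m `^ p)%:E)%E.
Proof.
move=> T2 m1; have t0 : 0 < t by exact: expR_gt0.
have m0 : 0 < m by exact: lt_le_trans m1.
have l0 : 0 <= ln m by exact: ln_ge0.
have Ts0 : 0 <= T `^ (2 - p) by exact: powR_ge0.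
have lp0 : 0 <= ln m `^ p by exact: powR_ge0.
have mE : m = expR (ln m) by rewrite lnK.
have [l1|l1] := leP (ln m) 1.
  have mt : m < t by rewrite mE /t ltr_expR; lra.
  apply: (le_trans (coord_risk_le_small m0 mt)); rewrite lee_fin; apply: lerD.
    rewrite ler_wpM2l// ler_expR mulNr lerN2 mulrC ler_wpM2r ?(ltW t0)//.
    by rewrite lef_pV2 ?posrE ?mulr_gt0 ?expR_gt0// ler_wpM2l// mE ler_expR.
  have : ln m ^+ 2 <= ln m `^ p.
    have [->|lm0] := eqVneq (ln m) 0; first by rewrite expr0n powR_ge0.
    rewrite powR_split; last by rewrite lt0r lm0.
    rewrite ler_piMr// -[leRHS]/((fun=> 1 : R) (2 - p)) -powR1.
    by apply: ge0_ler_powR; rewrite ?nnegrE// subr_ge0 ltW.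
  nra.
apply: (le_trans (coord_risk_le_gen t0 m0)); rewrite lee_fin.
have l10 : 0 < ln m by lra.
have lp1 : 1 <= ln m `^ p.
  by rewrite -[leLHS]/((fun=> 1 : R) p) -powR1; apply: ge0_ler_powR; rewrite ?nnegrE ?(ltW p0)// ltW.
have q0 : 0 <= 16 * expR (- (t / (2 * expR 1))) by rewrite mulr_ge0 ?expR_ge0.
suff : ln m ^+ 2 * (1 - expR (- m^-1 * t)) <= T `^ (2 - p) * ln m `^ p by nra.
rewrite powR_split// -mulrA [leRHS]mulrC ler_wpM2l//.
have [lT|Tl] := leP (ln m) T.
  apply: (@le_trans _ _ (ln m `^ (2 - p))).
    by rewrite ler_piMr ?powR_ge0// gerBl expR_ge0.
  by apply: ge0_ler_powR; rewrite ?nnegrE ?subr_ge0 ?(ltW p2)//; lra.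
have s0 : 0 <= 2 - p by rewrite subr_ge0 ltW.
have s2 : 2 - p <= 2 by rewrite gerBl ltW.
apply: le_trans (powR_le_expR s0 s2 T2 (ltW Tl)).
rewrite ler_wpM2l ?powR_ge0//.
have := expR_ge1Dx (- m^-1 * t).
have -> : expR (T - ln m) = m^-1 * t by rewrite expRD expRN lnK// mulrC.
lra.
Qed.

Lemma expRN_lt (x : R) : 0 < x -> expR (- x) < x^-1.
Proof.
move=> x0; rewrite expRN ltf_pV2 ?posrE ?expR_gt0//.
by apply: lt_le_trans (expR_ge1Dx x); rewrite ltrDr.
Qed.

(* With [t = e^T] and [eta^p = e^(- t / 2e)] both risks are [~ eta^p T^(2-p)];
   the spike height [T - S] loses only a constant [S] that makes the spikes
   undetectable. *)
Lemma minimax_limit_sparse_ge (T K : R) (S := 1 + ln (4 * K))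
    (r := expR (- (expR T / (4 * expR 1)))) (eta : R) :
  1 <= K -> S + 1 <= T -> eta `^ p = r ^+ 2 ->
  r ^+ 2 * (T - S) `^ (2 - p) * (1 - r) ^+ 2 * (1 - expR (- K)) <= minimax_limit eta.
Proof.
move=> K1 ST etap; have K0 : 0 < K by lra.
have r0 : 0 < r by exact: expR_gt0.
have r1 : r < 1.
  by rewrite -expR0 ltr_expR oppr_lt0 divr_gt0 ?mulr_gt0 ?expR_gt0.
pose th := T - S; have th1 : 1 <= th by rewrite /th; lra.
have th0 : 0 < th by lra.
pose q := r ^+ 2; have q0 : 0 < q by rewrite exprn_gt0.
have qr : q <= r by rewrite /q; nra.
have thp1 : 1 <= th `^ p.
  rewrite -[leLHS]/((fun=> 1 : R) p) -powR1.
  by apply: ge0_ler_powR; rewrite ?nnegrE ?(ltW p0)// ltW.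
have thp0 : 0 <= th `^ p / q by rewrite divr_ge0 ?powR_ge0// ltW.
(* Rounded up so that one spike fits into the budget [n eta^p]. *)
pose n := (Num.truncn (th `^ p / q)).+1.
have /andP[tr1 tr2] := @truncn_itv R _ thp0.
have nq : th `^ p <= n%:R * eta `^ p.
  by rewrite etap -/q -ler_pdivrMr// ltW.
(* The shift [S] is designed for this identity: the likelihood factor [expR (- (K expR th))] becomes
   [r], the square root of [eta^p]. *)
have KE : K * expR th = expR T / (4 * expR 1).
  rewrite /th /S expRD expRN expRD lnK ?posrE ?mulr_gt0//.
  by field; rewrite !gt_eqF ?expR_gt0.
have := minimax_limit_ge (ltW th0) K0 nq (ltn0Sn _).
rewrite KE -/r => /(le_trans _); apply.
have K1e : 0 <= 1 - expR (- K) by rewrite subr_ge0 -expR0 ler_expR; lra.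
rewrite [leRHS]mulrA ler_wpM2r//.
set c := _%:R * r.
have nq1 : q^-1 <= n%:R by apply: le_trans (ltW tr2); rewrite ler_peMl// invr_ge0 ltW.
(* At least [r^-2] positions meet a likelihood factor [r], so the odds [c] against any given
   position are of order [r^-1] or more, and [c / (1 + c)] loses at most [r]. *)
have cr : r^-1 - r <= c.
  have : q^-1 - 1 <= (n.-1)%:R.
    have : n%:R = (n.-1)%:R + 1 :> R by rewrite natr1.
    by move: nq1; lra.
  rewrite -(ler_pM2r r0) -/c mulrBl mul1r; apply: le_trans.
  by rewrite /q expr2 invfM -mulrA mulVf ?gt_eqF// mulr1.
have ri : 1 < r^-1 by rewrite invf_gt1.
have c0 : 0 < c by lra.
have c1 : 1 - r <= c / (1 + c).
  rewrite ler_pdivlMr; last lra.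
  have : 1 - r <= r * (r^-1 - r) by rewrite mulrBr divff ?gt_eqF//; nra.
  have : r * (r^-1 - r) <= r * c by rewrite ler_wpM2l// ltW.
  nra.
(* Rounding [n] up costs a factor [1 - r], because [q <= r] and [th^p >= 1]. *)
have n1 : q * (1 - r) <= n%:R^-1 * th `^ p.
  have nr0 : 0 < n%:R :> R by rewrite ltr0n.
  rewrite [leRHS]mulrC ler_pdivlMr//.
  have : n%:R <= th `^ p / q + 1 by rewrite -natr1 lerD2r.
  move=> /(ler_wpM2r (ltW q0)); rewrite mulrDl mul1r divfK ?gt_eqF// => h.
  have h5 : n%:R * q * (1 - r) <= (th `^ p + q) * (1 - r) by rewrite ler_wpM2r//; lra.
  have h6 : r <= r * th `^ p by rewrite ler_peMr// ltW.
  have h7 : 0 <= q * r by rewrite mulr_ge0// ltW.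
  lra.
rewrite (powR_split th0) -/th -/q.
have s0 : 0 <= th `^ (2 - p) by exact: powR_ge0.
apply: (@le_trans _ _ (n%:R^-1 * th `^ p * (th `^ (2 - p) * (1 - r)))); last first.
  rewrite [leRHS](_ : _ = n%:R^-1 * th `^ p * (th `^ (2 - p) * (c / (1 + c)))); last by ring.
  rewrite ler_wpM2l ?mulr_ge0 ?invr_ge0 ?powR_ge0//.
  by rewrite ler_wpM2l.
rewrite [leLHS](_ : _ = q * (1 - r) * (th `^ (2 - p) * (1 - r))); last by ring.
by rewrite ler_wpM2r// mulr_ge0//; lra.
Qed.

Lemma thresh_minimax_ratio (eps d : R) : 0 < eps -> 0 < d -> exists eta t,
  [/\ 0 < eta, eta < d, 0 < t & thresh_limit eta t <= (1 + eps) * minimax_limit eta].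
Proof.
move=> eps0 d0.
have s0 : 0 < 2 - p by rewrite subr_gt0.
(* Solves [(1 + eps) (1 - 5 dl) = 1 + dl]: five factors [1 - dl] are lost below, and the remaining
   [dl] absorbs the constant 35. *)
pose dl := eps / (6 + 5 * eps).
have dl0 : 0 < dl by rewrite divr_gt0//; lra.
have dlE : dl * (6 + 5 * eps) = eps by rewrite divfK// gt_eqF//; lra.
have dl5 : 5 * dl <= 1 by nra.
pose K := dl^-1.
have K1 : 5 <= K by rewrite /K -[leLHS]invrK lef_pV2 ?posrE// ?invr_gt0//; lra.
have Kd : expR (- K) <= dl by rewrite -[leRHS]invrK ltW// expRN_lt// -/K; lra.
pose S := 1 + ln (4 * K).
have S0 : 0 < S by rewrite /S ltr_wpDr// ln_ge0//; lra.
have e1 : 0 < expR 1 :> R by exact: expR_gt0.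
(* The summands secure in turn [2 <= T] and [S + 1 <= T], [S <= dl T], [35 <= dl T^(2-p)] with
   [35 = 16 + 19], [r <= dl], and [eta < d]. *)
pose T := 2 + S + S / dl + (35 / dl) `^ (2 - p)^-1 + 4 * expR 1 / dl + 2 * expR 1 * p / d.
have h1 : 0 <= S / dl by rewrite divr_ge0// ltW.
have h2 : 0 <= (35 / dl) `^ (2 - p)^-1 by exact: powR_ge0.
have h3 : 0 <= 4 * expR 1 / dl by rewrite ltW// divr_gt0// mulr_gt0.
have h4 : 0 <= 2 * expR 1 * p / d by rewrite ltW// divr_gt0// !mulr_gt0.
have T2 : 2 <= T by rewrite /T; lra.
have T0 : 0 < T by lra.
have ST : S + 1 <= T by rewrite /T; lra.
have STd : S <= dl * T.
  by rewrite mulrC -ler_pdivrMr// /T; lra.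
have Ts : 35 / dl <= T `^ (2 - p).
  rewrite -[leLHS](@powRr1 _ (35 / dl)); last by rewrite divr_ge0// ltW.
  rewrite -[X in _ `^ X](mulVf (lt0r_neq0 s0)) powRrM.
  apply: ge0_ler_powR; rewrite ?nnegrE ?(ltW s0) ?(ltW T0)//.
  by rewrite /T; lra.
pose t := expR T.
have t0 : 0 < t by exact: expR_gt0.
have tT : T < t by have := expR_ge1Dx T; rewrite -/t; lra.
pose r := expR (- (t / (4 * expR 1))).
have rd : r <= dl.
  apply: (@le_trans _ _ (t / (4 * expR 1))^-1).
    by rewrite ltW// expRN_lt// divr_gt0// mulr_gt0.
  rewrite invf_div ler_pdivrMr// [leRHS]mulrC -ler_pdivrMr//.
  by apply: le_trans (ltW tT); rewrite /T; lra.
pose eta := expR (- (t / (2 * expR 1 * p))).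
have eta0 : 0 < eta by exact: expR_gt0.
have etap : eta `^ p = r ^+ 2.
  rewrite /eta /r /powR gt_eqF ?expR_gt0// expRK -expRM_natl; congr expR.
  by field; rewrite !gt_eqF.
have r2 : r ^+ 2 = expR (- (t / (2 * expR 1))).
  by rewrite /r -expRM_natl; congr expR; field; rewrite gt_eqF.
exists eta, t; split => //.
  apply: (@lt_le_trans _ _ (t / (2 * expR 1 * p))^-1).
    by rewrite expRN_lt// divr_gt0// !mulr_gt0.
  rewrite invf_div ler_pdivrMr// [leRHS]mulrC -ler_pdivrMr//.
  by apply: le_trans (ltW tT); rewrite /T; lra.
have Ts0 : 0 <= T `^ (2 - p) by exact: powR_ge0.
have q0 : 0 < r ^+ 2 by rewrite exprn_gt0// expR_gt0.
apply: (@le_trans _ _ (r ^+ 2 * (35 + T `^ (2 - p)))).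
  apply: thresh_limit_le => // n.
  rewrite [X in X%:E](_ : _ = 16 * r ^+ 2 + (19 + T `^ (2 - p)) * eta `^ p); last by rewrite etap; ring.
  apply: max_risk_thresh_le => //.
  - by rewrite mulr_ge0// ltW.
  - by rewrite addr_ge0.
  - by move=> m m1; rewrite r2; exact: coord_risk_sparse.
have := @minimax_limit_sparse_ge T K eta (le_trans _ K1) ST etap.
rewrite -/t -/r -/S => /(_ ltac:(lra)) hB.
have e10 : 0 <= 1 + eps by lra.
apply: (le_trans _ (ler_wpM2l e10 hB)).
(* Two of the five factors arise here, from [(1 - S / T)^(2-p) >= (1 - S / T)^2]; two more come from
   [(1 - r)^2] and the last from the truncation at [K]. *)
have ThS : T `^ (2 - p) * (1 - dl) ^+ 2 <= (T - S) `^ (2 - p).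
  have -> : T - S = T * (1 - S / T) by rewrite mulrBr mulr1 mulrCA divff ?gt_eqF// mulr1.
  have x0 : 0 < 1 - S / T by rewrite subr_gt0 ltr_pdivrMr// mul1r; lra.
  have x1 : 1 - S / T <= 1 by rewrite gerBl divr_ge0 ?(ltW S0) ?(ltW T0).
  have xd : 1 - dl <= 1 - S / T by rewrite lerB// ler_pdivrMr.
  rewrite powRM ?(ltW T0) ?(ltW x0)// ler_wpM2l//.
  apply: (@le_trans _ _ ((1 - S / T) ^+ 2)).
    by rewrite lerXn2r ?nnegrE ?(ltW x0)//; lra.
  rewrite powR_split// mulrC -[leRHS]mulr1 ler_wpM2l ?powR_ge0//.
  rewrite -[leRHS]/((fun=> 1 : R) p) -powR1.
  by apply: ge0_ler_powR; rewrite ?nnegrE ?(ltW p0) ?(ltW x0).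
have q1 : (1 - dl) ^+ 2 <= (1 - r) ^+ 2.
  by rewrite lerXn2r ?nnegrE; lra.
have k1 : 1 - dl <= 1 - expR (- K) by rewrite lerB.
have dl1 : 0 <= 1 - dl by lra.
have d2 : 0 <= (1 - dl) ^+ 2 by exact: sqr_ge0.
apply: (@le_trans _ _ ((1 + eps) * (r ^+ 2 * (T `^ (2 - p) * (1 - dl) ^+ 2) * (1 - dl) ^+ 2 * (1 - dl)))); last first.
  have A0 : 0 <= r ^+ 2 * (T `^ (2 - p) * (1 - dl) ^+ 2).
    by apply: mulr_ge0; [exact: ltW|exact: mulr_ge0].
  rewrite ler_wpM2l//; apply: ler_pM => //; first exact: mulr_ge0.
  by apply: ler_pM => //; rewrite ler_wpM2l// ltW.
rewrite [leRHS](_ : _ = r ^+ 2 * ((1 + eps) * (1 - dl) ^+ 5 * T `^ (2 - p))); last by ring.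
rewrite ler_wpM2l ?(ltW q0)//.
have b5 : 1 - 5 * dl <= (1 - dl) ^+ 5.
  have b2 : 1 - 2 * dl <= (1 - dl) ^+ 2 by nra.
  have b4 : 1 - 4 * dl <= (1 - dl) ^+ 4 by rewrite (exprM _ 2 2); nra.
  by rewrite exprS; nra.
have b6 : 1 + dl <= (1 + eps) * (1 - dl) ^+ 5.
  by apply: le_trans (ler_wpM2l e10 b5); nra.
have : 35 <= dl * T `^ (2 - p) by rewrite mulrC -ler_pdivrMr.
have := ler_wpM2r Ts0 b6; lra.
Qed.

End asymptotics.

Theorem theorem1p2 (R : realType) (p : R) (hp0 : 0 < p) (hp2 : p < 2) :
  (forall eta t : R, 0 < eta -> 0 < t ->
     cvg (thresh_ratio p eta t n @[n --> \oo])) /\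
  limf_einf
    ((fun eta : R =>
       ereal_inf [set lim (thresh_ratio p eta t n @[n --> \oo]) | t in `]0, +oo[])
       : R^o -> \bar R)
    (0 : R^o)^'+
  = 1%E.
Proof.
split=> [eta t eta0 t0|].
  by apply/cvg_ex; eexists; exact: cvg_thresh_ratio.
have limE eta t : 0 < eta -> 0 < t -> lim (thresh_ratio p eta t n @[n --> \oo]) =
    (thresh_limit p eta t / minimax_limit p eta)%:E.
  by move=> eta0 t0; apply/cvg_lim => //; exact: cvg_thresh_ratio.
rewrite limf_einfE; apply/eqP; rewrite eq_le; apply/andP; split.
  (* The liminf is a supremum over neighbourhoods. Each contains some interval []0, d[], so one
     suitable [eta < d] bounds its infimum. *)
  apply: ge_ereal_sup => _ [V V0 <-]; apply/lee_addgt0Pr => eps eps0.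
  have [d /= d0 dV] := V0.
  have [eta [t [eta0 etad t0 h]]] := thresh_minimax_ratio hp0 hp2 eps0 d0.
  apply: (@le_trans _ _ (lim (thresh_ratio p eta t n @[n --> \oo]))).
    apply: (@le_trans _ _ (ereal_inf [set lim (thresh_ratio p eta t n @[n --> \oo]) | t in `]0, +oo[])).
      apply: ereal_inf_lbound; exists eta => //; apply: dV => //=.
      by rewrite sub0r normrN gtr0_norm.
    by apply: ereal_inf_lbound; exists t => //=; rewrite in_itv/= t0.
  by rewrite limE// -EFinD lee_fin ler_pdivrMr// minimax_limit_gt0.
(* Here the single neighbourhood of all positive [eta] is enough, by [minimax_limit_le]. *)
apply: (@le_trans _ _ (ereal_inf
  ((fun eta : R => ereal_inf [set lim (thresh_ratio p eta t n @[n --> \oo]) | t in `]0, +oo[])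
   @` [set eta : R | 0 < eta]))).
  apply: le_ereal_inf_tmp => _ [eta eta0 <-] /=.
  apply: le_ereal_inf_tmp => _ [t + <-]; rewrite /= in_itv/= andbT => t0.
  rewrite limE// lee_fin ler_pdivlMr ?minimax_limit_gt0// mul1r.
  exact: minimax_limit_le.
apply: ereal_sup_ubound; exists [set eta : R | 0 < eta] => //.
exact: nbhs_right_gt.
Qed.
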